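(* For any $\alpha>0$ and $T>0$, there exist $u_0\in \mathrm{BPC}^1(\mathbb{R})$ and a sequence $\{(f_n,u_0,u_n)\}_{n\in\mathbb{N}}$ with $(f_n,u_0,u_n)\in\mathcal{I}_T^\alpha$ for every $n\in\mathbb{N}$, such that $$\lim_{n\to\infty}\left(\inf_{t\in(0,T]}\left(\|(u_n)_x(\cdot,t)\|_B-\mathcal{F}_t(f_n,u_0,u_n)\right)\right)=0 .$$
   Context: For $\lambda>0$ let $D_\lambda=\mathbb{R}\times(0,\lambda]$, $\bar D_\lambda=\mathbb{R}\times[0,\lambda]$ and $\partial D=\mathbb{R}\times\{0\}$. $B_A^\lambda$ is the space of bounded continuous functions $u:\bar D_\lambda\to\mathbb{R}$. $B_B$ is the space of bounded continuous functions $\mathbb{R}\to\mathbb{R}$, with sup norm $\|v\|_B=\sup_{x\in\mathbb{R}}|v(x)|$. $\mathrm{BPC}^1(\mathbb{R})$ is the set of bounded, continuous functions $v:\mathbb{R}\to\mathbb{R}$ with piecewise continuous bounded derivative $v'$; $\|v'\|_B$ denotes the supremum of $|v'|$ (where $v'$ is defined). $\mathcal{A}_\lambda=\{(f,v,u): f\in C(\mathbb{R}),\ v\in \mathrm{BPC}^1(\mathbb{R}),\ u\in B_A^\lambda\}$, and $\mathcal{F}_\lambda:\mathcal{A}_\lambda\to[0,\infty)$ is $$\mathcal{F}_\lambda(f,v,u)=\|v'\|_B+\frac{1}{\sqrt{\pi}}\int_0^\lambda\frac{\|f(u(\cdot,\tau))\|_B}{(\lambda-\tau)^{1/2}}\,d\tau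 .$$ For $(f,v,u)\in\mathcal{A}_T$ and $0<t\le T$, $\mathcal{F}_t(f,v,u)$ means $\mathcal{F}_t(f,v,u|_{\bar D_t})$. For $T>0$, $f\in C(\mathbb{R})$, $u_0\in \mathrm{BPC}^1(\mathbb{R})$, a solution to [IVP] with $f$ and $u_0$ is a function $u:\bar D_T\to\mathbb{R}$ with $u\in C(\bar D_T)\cap C^{2,1}(D_T)\cap L^\infty(\bar D_T)$ ($C^{2,1}$: $u_t,u_x,u_{xx}$ exist and are continuous) such that $u_t-u_{xx}=f(u)$ on $D_T$ and $u=u_0$ on $\partial D$. $\mathcal{I}_T$ is the set of $(f,u_0,u)\in\mathcal{A}_T$ such that $u:\bar D_T\to\mathbb{R}$ is a solution to [IVP] with $f$ and $u_0$. For $\alpha>0$, $\mathcal{I}_T^\alpha=\{(f,u_0,u)\in\mathcal{I}_T:\ \|u_x(\cdot,T)\|_B\ge\alpha\}$. *)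

(* Defs.v *)
From HB Require Import structures.
From mathcomp Require Import all_boot all_order all_algebra.
From mathcomp Require Import all_classical all_reals all_analysis.
Set Implicit Arguments.
Unset Strict Implicit.
Unset Printing Implicit Defensive.
Import Order.TTheory GRing.Theory Num.Theory.
Import numFieldNormedType.Exports.
Local Open Scope classical_set_scope.
Local Open Scope ring_scope.

(* A function on the closed strip R x [0, lam] is represented by a total
   function u : R -> R -> R, written u x t; every notion below depends only on
   the values of u on the strip. *)

Section Strip.
Context {R : realType}.
Implicit Types (f v : R -> R) (u : R -> R -> R) (lam T t x : R).

Definition strip lam : set (R * R) := [set z | 0 < z.2 <= lam].

Definition cstrip lam : set (R * R) := [set z | 0 <= z.2 <= lam].

(* Extended-real valued, because the real [sup] of an unbounded set is 0. *)
Definition normB v : \bar R := ereal_sup [set `|v x|%:E | x in [set: R]].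

Definition norm_deriv v : \bar R :=
  ereal_sup [set `|derive1 v x|%:E | x in [set x | derivable v x 1]].

(* S contains the points where v' jumps or is undefined; it is locally finite
   and v' has finite one-sided limits at its points. *)
Definition piecewise_continuous_deriv v : Prop :=
  exists S : set R,
    [/\ forall a b : R, finite_set (S `&` `[a, b]),
        forall x, ~ S x -> derivable v x 1 /\ {for x, continuous (derive1 v)}
      & forall x, S x -> cvg (derive1 v @ x^'-) /\ cvg (derive1 v @ x^'+)].

Definition BPC1 v : Prop :=
  [/\ [bounded v x | x in [set: R]],
      continuous v,
      piecewise_continuous_deriv v
    & [bounded derive1 v x | x in [set x | derivable v x 1]]].

Definition BA lam u : Prop :=
  [bounded u z.1 z.2 | z in cstrip lam] /\
  {within cstrip lam, continuous (fun z : R * R => u z.1 z.2)}.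

Definition admissible lam f v u : Prop :=
  [/\ continuous f, BPC1 v & BA lam u].

Definition calF lam f v u : \bar R :=
  (norm_deriv v +
   (Num.sqrt pi)^-1%:E *
   \int[lebesgue_measure]_(tau in `[0%R, lam[)
     (normB (fun x => f (u x tau)) * (Num.sqrt (lam - tau))^-1%:E))%E.

Definition dx u x t : R := derive1 (fun y => u y t) x.

Definition dxx u x t : R := derive1 (fun y => dx u y t) x.

(* The time derivative is relative to the domain ]0, T], hence one-sided at
   t = T. *)
Definition dt_filter T u x t : set_system R :=
  (fun s => (u x s - u x t) / (s - t)) @ within `]0, T] t^'.

Definition dt T u x t : R := lim (dt_filter T u x t).

Definition C21 T u : Prop :=
  [/\ forall x t, 0 < t <= T ->
        [/\ cvg (dt_filter T u x t),
            derivable (fun y => u y t) x 1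
          & derivable (fun y => dx u y t) x 1],
      {within strip T, continuous (fun z : R * R => dt T u z.1 z.2)},
      {within strip T, continuous (fun z : R * R => dx u z.1 z.2)}
    & {within strip T, continuous (fun z : R * R => dxx u z.1 z.2)}].

Definition IVP_solution T f (u0 : R -> R) u : Prop :=
  [/\ {within cstrip T, continuous (fun z : R * R => u z.1 z.2)},
      C21 T u,
      [bounded u z.1 z.2 | z in cstrip T],
      forall x t, 0 < t <= T -> dt T u x t - dxx u x t = f (u x t)
    & forall x, u x 0 = u0 x].

Definition calI T f (u0 : R -> R) u : Prop :=
  admissible T f u0 u /\ IVP_solution T f u0 u.

Definition calI_alpha (alpha : R) T f (u0 : R -> R) u : Prop :=
  calI T f u0 u /\ (alpha%:E <= normB (fun x => dx u x T))%E.

End Strip.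

(* Main.v *)
(* For u0 = 0 the self-similar ansatz u(x, t) = lam t^q w(x / sqrt t), with
   q = 1 / (1 - p) and f(u) = lam |u / lam|^p sgn u, turns the PDE into

     - w'' - (eta / 2) w' + w = |w|^p sgn w - (q - 1) w,

   where the right-hand side tends to sgn eta as p -> 0.  If |w| <= 1, then
   F_t <= lam t^(q - 1/2) 2 / sqrt pi, whereas |u_x(., t)| is at least
   lam t^(q - 1/2) w'(0).  For the right-hand side 1 on eta > 0 the explicit
   solution vanishing at 0 has slope exactly 2 / sqrt pi, and a comparison
   argument shows that w'(0) gets as close to it as desired.  The infimum over
   t is at most 0 because |u_x(., t)| tends to 0 as t -> 0.

   Although |w|^p is not Lipschitz at 0, the fixed point w is obtained by
   contraction: every iterate stays above a multiple of int_0^eta e^{-s^2/4} ds,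
   and in the norm weighted by that function the map is O(p)-Lipschitz. *)

Require Import Defs.
From HB Require Import structures.
From mathcomp Require Import all_boot all_order all_algebra.
From mathcomp Require Import all_classical all_reals all_analysis.
From mathcomp Require Import measurable_realfun ring lra.
Import Order.TTheory GRing.Theory Num.Theory.
Import numFieldNormedType.Exports.
Local Open Scope classical_set_scope.
Local Open Scope ring_scope.
Set Implicit Arguments.
Unset Strict Implicit.
Unset Printing Implicit Defensive.

(** * Comparison by derivatives, and antiderivatives on the whole line *)

Section calculus.
Context {R : realType}.
Implicit Types f df F : R -> R.

(** The weight 1 / sqrt (pi (t - tau)) in F_t is the L^1 norm of the x-derivative of the heat
    kernel. With u0 = 0 the bound of |u_x(0, t)| by F_t would therefore be attained if f(u) were a
    nonnegative function of time times sgn x. Since f(u) is continuous in x, this can only be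
    approached; and an odd Lipschitz f would leave only u = 0 for zero data.

    The analysis of the profile equation rests on one explicit solution of its homogeneous form, x^2
    + 2. Dividing by it leaves two first-order equations, which yield existence by two
    antiderivatives and comparison on the half-line. Homogeneous solutions vanishing at 0 grow
    quadratically, so comparison is stated for functions that are o(x^2 + 2), and existence has to
    select the homogeneous term that cancels this growth. Profiles are odd, which gives the value 0
    at the origin and reduces all estimates to x >= 0. *)

Lemma is_derive_continuous f (x l : R) :
  is_derive x 1 f l -> {for x, continuous f}.
Proof. by case=> dfx _; apply/differentiable_continuous/derivable1_diffP. Qed.

Lemma mean_value f df (a b : R) : a <= b ->
  (forall x, a <= x <= b -> is_derive x 1 f (df x)) ->
  exists2 c, a <= c <= b & f b - f a = df c * (b - a).
Proof.
move=> ab fdf; have [x xab||c cab e] := @MVT_segment _ f df _ _ ab.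
- by apply: fdf; move: xab; rewrite in_itv/= => /andP[/ltW-> /ltW->].
- by apply: derivable_within_continuous => x; rewrite in_itv/= => /fdf[].
- by exists c => //; move: cab; rewrite in_itv.
Qed.

Lemma derive_ge0_le f df (a b : R) : a <= b ->
  (forall x, a <= x <= b -> is_derive x 1 f (df x)) ->
  (forall x, a <= x <= b -> 0 <= df x) -> f a <= f b.
Proof.
move=> ab fdf df0; have [c cab e] := mean_value ab fdf.
by rewrite -subr_ge0 e mulr_ge0 ?df0// subr_ge0.
Qed.

Lemma derive_le f df F dF (a b : R) : a <= b ->
  (forall x, a <= x <= b -> is_derive x 1 f (df x)) ->
  (forall x, a <= x <= b -> is_derive x 1 F (dF x)) ->
  (forall x, a <= x <= b -> df x <= dF x) -> f b - f a <= F b - F a.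
Proof.
move=> ab fdf FdF dfF.
have H := @derive_ge0_le (F - f) (fun x => dF x - df x) a b ab.
have {H} : F a - f a <= F b - f b.
  apply: H => x xab; first by apply: is_deriveB; [exact: FdF|exact: fdf].
  by rewrite subr_ge0 dfF.
lra.
Qed.

Lemma derive_eq f df F (x : R) :
  (forall y : R, is_derive y 1 f (df y)) -> (forall y : R, is_derive y 1 F (df y)) ->
  f 0 = F 0 -> f x = F x.
Proof.
move=> fdf FdF f0; have := @is_derive_0_is_cst _ (f - F) x 0.
rewrite !fctE f0 subrr => /(_ _)/eqP; rewrite subr_eq0 => H; apply/eqP/H => y.
by apply: is_derive_eq; rewrite subrr.
Qed.

(** The integral is differentiated only to the right of its lower limit, so this limit is put at
    [- (|x| + 1)] and moves with [x]; subtracting the value at 0 makes the choice immaterial. *)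
Lemma exists_antiderivative f : continuous f ->
  exists F, F 0 = 0 /\ forall x : R, is_derive x 1 F (f x).
Proof.
move=> cf; pose G a x := \int[lebesgue_measure]_(t in `[a, x]) f t : R.
have dG (a x : R) : a < x -> is_derive x 1 (G a) (f x).
  move=> ax; have [||||dGa <-] := @continuous_FTC1_closed R f a x (x + 1).
  - by rewrite ltrDl.
  - apply: continuous_compact_integrable; first exact: segment_compact.
    exact: continuous_subspaceT.
  - exact: ax.
  - exact: cf.
  - by split; rewrite ?derive1E.
have GE (a b x : R) : a <= b -> b < x -> b < 0 -> G a x - G a 0 = G b x - G b 0.
  move=> ab bx b0; pose D y := G a y - G b y.
  have dD (y : R) : b < y -> is_derive y 1 D 0.
    move=> b_y; have := dG _ _ b_y; have := dG _ _ (le_lt_trans ab b_y).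
    by move=> *; apply: is_derive_eq; rewrite subrr.
  suff : D x = D 0 by rewrite /D; lra.
  have [x0|/ltW x0] := leP x 0.
    have [|c _] := @mean_value D (fun=> 0) _ _ x0.
      by move=> y /andP[xy _]; apply/dD/(lt_le_trans bx).
    by rewrite mul0r => /eqP; rewrite subr_eq0 => /eqP.
  have [|c _] := @mean_value D (fun=> 0) _ _ x0.
    by move=> y /andP[xy _]; apply/dD/(lt_le_trans b0).
  by rewrite mul0r => /eqP; rewrite subr_eq0 => /eqP.
exists (fun x => G (- (`|x| + 1)) x - G (- (`|x| + 1)) 0).
split=> [|x]; first by rewrite subrr.
(* For y within distance 1 of x the lower limit [- (|y| + 1)] is at least [a], so [GE] replaces all
   of them by [a]. *)
pose a := - (`|x| + 2).
have ax : a < x by rewrite /a; case: (ler0P x); lra.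
have := dG _ _ ax => dGa.
apply: (@near_eq_is_derive _ _ _ (fun y => G a y - G a 0)); last first.
  by apply: is_derive_eq; rewrite subr0.
near=> y; have yx : `|x - y| < 1.
  by near: y; exact: cvgr_dist_lt.
rewrite -(GE a) // /a.
- by have := ler_normB x (x - y); rewrite subKr; lra.
- by have := ler_norm (- y); rewrite normrN; lra.
Unshelve. all: by end_near. Qed.

End calculus.

(** * The profile equation: comparison principle and derivative bound on the half-line *)

Section profile_equation.
Context {R : realType}.
Implicit Types (w dw z dz h g : R -> R) (x M : R).

(** The polynomial solution of - w'' - (x / 2) w' + w = 0. *)
Definition phi x : R := x ^+ 2 + 2.

Lemma phi_gt0 x : 0 < phi x.
Proof. by rewrite /phi; nra. Qed.

Lemma phi_ge0 x : 0 <= phi x.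
Proof. exact/ltW/phi_gt0. Qed.

Lemma phi_neq0 x : phi x != 0.
Proof. by rewrite gt_eqF ?phi_gt0. Qed.

Lemma phi_ge x : 2 * x <= phi x.
Proof. by rewrite /phi; nra. Qed.

(* w solves - w'' - (x / 2) w' + w = h on the whole line. *)
Definition profile_eq w dw h := forall x,
  is_derive x 1 w (dw x) /\ is_derive x 1 dw (w x - x / 2 * dw x - h x).

Lemma profile_eq_lin (a b : R) w1 dw1 h1 w2 dw2 h2 :
  profile_eq w1 dw1 h1 -> profile_eq w2 dw2 h2 ->
  profile_eq (fun x => a * w1 x + b * w2 x) (fun x => a * dw1 x + b * dw2 x)
             (fun x => a * h1 x + b * h2 x).
Proof.
move=> H1 H2 x; have [? ?] := H1 x; have [? ?] := H2 x.
by split; apply: is_derive_eq; rewrite /GRing.scale/=; ring.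
Qed.

(** This is z = o(phi) at +oo, the growth condition that rules out nonzero multiples of [phi] in
    comparisons on x >= 0. *)
Definition subquadratic z := forall e : R, 0 < e ->
  exists A : R, forall x, A <= x -> `|z x| <= e * phi x.

Lemma bounded_subquadratic z M :
  (forall x, 0 <= x -> `|z x| <= M) -> subquadratic z.
Proof.
move=> zM e e0; have M0 : 0 <= M := le_trans (normr_ge0 _) (zM 0 (lexx _)).
exists (M / e) => x Mx.
have x0 : 0 <= x by apply: le_trans Mx; rewrite divr_ge0// ltW.
apply: (le_trans (zM _ x0)); rewrite mulrC -ler_pdivrMr//.
by apply: (le_trans Mx); rewrite /phi; nra.
Qed.

Lemma subquadratic_lin (a b : R) z1 z2 : subquadratic z1 -> subquadratic z2 ->
  subquadratic (fun x => a * z1 x + b * z2 x).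
Proof.
move=> s1 s2 e e0.
have k0 : 0 < e / (`|a| + `|b| + 1).
  by rewrite divr_gt0// ltr_wpDl// addr_ge0.
have [A HA] := s1 _ k0; have [B HB] := s2 _ k0.
exists (Num.max A B) => x; rewrite ge_max => /andP[/HA Ax /HB Bx].
apply: (le_trans (ler_normD _ _)); rewrite !normrM.
set k := e / _ in k0 Ax Bx *.
have -> : e = k * (`|a| + `|b| + 1).
  by rewrite /k divfK// gt_eqF// ltr_wpDl// addr_ge0.
have := phi_gt0 x.
have := ler_wpM2l (normr_ge0 a) Ax; have := ler_wpM2l (normr_ge0 b) Bx.
have := normr_ge0 a; have := normr_ge0 b; nra.
Qed.

(* With v = z / phi the equation becomes (phi^2 e^{x^2/4} v')' = - phi e^{x^2/4} g,
   because phi itself solves the homogeneous equation; hence once v' is negative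
   it stays so. *)
Lemma profile_eq_ge0 z dz g : profile_eq z dz g ->
  (forall x, 0 <= x -> 0 <= g x) -> 0 <= z 0 -> subquadratic z ->
  forall x, 0 <= x -> 0 <= z x.
Proof.
move=> eqz g0 z00 sz x0 x00; rewrite leNgt; apply/negP => zx0.
pose W x := (dz x * phi x - 2 * x * z x) * expR (x ^+ 2 / 4).
pose v x := z x * (phi x)^-1.
have dW x : is_derive x 1 W (- (g x * phi x * expR (x ^+ 2 / 4))).
  have [? ?] := eqz x; rewrite /W /phi.
  by apply: is_derive_eq; rewrite /GRing.scale/=; field.
have dphi x : is_derive x 1 phi (2 * x).
  by rewrite /phi; apply: is_derive_eq; rewrite /GRing.scale/=; ring.
have dv x : is_derive x 1 v (W x / (phi x ^+ 2 * expR (x ^+ 2 / 4))).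
  have [? ?] := eqz x; have := is_deriveV (phi_neq0 x) (dphi x) => ?.
  apply: is_derive_eq; rewrite /GRing.scale/= /W; field.
  by rewrite phi_neq0 gt_eqF ?expR_gt0.
have [c /andP[c0 cx0] e] := mean_value x00 (fun x _ => dv x).
have Wc : W c < 0.
  rewrite ltNge; apply/negP => Wc.
  have : 0 <= v x0 - v 0.
    by rewrite e subr0 mulr_ge0// divr_ge0// mulr_ge0 ?sqr_ge0 ?expR_ge0.
  rewrite subr_ge0 => H; have : v x0 < 0.
    by rewrite /v pmulr_llt0 ?invr_gt0 ?phi_gt0.
  by rewrite ltNge (le_trans _ H)// /v mulr_ge0// invr_ge0 ltW ?phi_gt0.
have Wy y : c <= y -> W y < 0.
  move=> cy; apply: le_lt_trans Wc; rewrite -lerN2.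
  apply: (@derive_ge0_le _ (fun x => - W x) (fun x => g x * phi x * expR (x ^+ 2 / 4)))
    => // x /andP[cx _].
    by have ? := dW x; apply: is_derive_eq; rewrite opprK.
  by rewrite !mulr_ge0 ?expR_ge0 ?g0 ?(le_trans c0 cx) ?phi_ge0.
have vy y : x0 <= y -> v y <= v x0.
  move=> xy; rewrite -lerN2.
  apply: (@derive_ge0_le _ (fun x => - v x)
    (fun x => - (W x / (phi x ^+ 2 * expR (x ^+ 2 / 4))))) => // x /andP[xx _].
  rewrite -mulNr divr_ge0//; first by rewrite oppr_ge0 ltW// Wy// (le_trans cx0).
  by rewrite mulr_ge0 ?sqr_ge0 ?expR_ge0.
have vx0 : v x0 < 0 by rewrite /v pmulr_llt0 ?invr_gt0 ?phi_gt0.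
(* Beyond [x0], z stays below the negative multiple [v x0] of [phi]; subquadratic growth with half
   of that multiple contradicts this. *)
have [|A HA] := sz (- v x0 / 2); first by rewrite divr_gt0// oppr_gt0.
set y := Num.max A x0.
have := HA y; rewrite le_max lexx => /(_ isT).
have := vy y; rewrite le_max lexx orbT => /(_ isT).
rewrite {1}/v ler_pdivrMr ?phi_gt0// => h1 h2.
have := phi_gt0 y; have := ler_norm (- z y); rewrite normrN; nra.
Qed.

(** The equation reads (w' e^{x^2/4})' = e^{x^2/4} (w - h), and 4 x e^{x^2/4} / phi is an explicit
    majorant of the integral of e^{x^2/4}: its derivative is e^{x^2/4} (2 - 8 x^2 / phi^2), and 8
    x^2 <= phi^2. Bounded w' will make u_x tend to 0 as t tends to 0. *)
Lemma profile_eq_deriv_le w dw h M : profile_eq w dw h ->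
  (forall x, 0 <= x -> `|w x| <= M) -> (forall x, 0 <= x -> `|h x| <= M) ->
  forall x, 0 <= x -> `|dw x| <= `|dw 0| + 4 * M.
Proof.
move=> eqw wM hM x x0; have M0 := le_trans (normr_ge0 _) (wM 0 (lexx _)).
pose E x : R := expR (x ^+ 2 / 4).
have E0 y : 0 < E y by exact: expR_gt0.
pose K x : R := 2 * M * (E x * (4 * x * (phi x)^-1)).
have dphi (y : R) : is_derive y 1 phi (2 * y).
  by rewrite /phi; apply: is_derive_eq; rewrite /GRing.scale/=; ring.
have dK (y : R) : is_derive y 1 K (2 * M * (E y * (2 - 8 * y ^+ 2 / phi y ^+ 2))).
  have := is_deriveV (phi_neq0 y) (dphi y) => ?.
  apply: is_derive_eq; rewrite /GRing.scale/= -/(E y).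
  rewrite [in LHS]/phi [in RHS]/phi; field.
  by have := phi_neq0 y; rewrite /phi.
have dwE (y : R) : is_derive y 1 (fun x => dw x * E x) (E y * (w y - h y)).
  have [? ?] := eqw y; apply: is_derive_eq; rewrite /GRing.scale/= -/(E y).
  by field.
have KE y : 0 <= y -> `|w y - h y| <= 2 * M * (2 - 8 * y ^+ 2 / phi y ^+ 2).
  move=> y0; apply: (le_trans (ler_normB _ _)).
  apply: (@le_trans _ _ (2 * M)); first by have := wM _ y0; have := hM _ y0; lra.
  apply: ler_peMr; first by lra.
  rewrite lerBrDl -lerBrDr ler_pdivrMr ?exprn_gt0 ?phi_gt0//.
  by rewrite /phi; have := sqr_ge0 (y ^+ 2 - 2); nra.
have K0 : K 0 = 0 by rewrite /K mulr0 mul0r !mulr0.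
have Ee0 : E 0 = 1 by rewrite /E expr0n/= mul0r expR0.
have up : dw x * E x - dw 0 * E 0 <= K x - K 0.
  apply: (derive_le x0) => y /andP[y0 _].
  rewrite mulrCA ler_wpM2l ?(ltW (E0 _))//.
  exact: le_trans (ler_norm _) (KE _ y0).
have lo : - (dw x * E x) - - (dw 0 * E 0) <= K x - K 0.
  apply: (@derive_le _ (fun x => - (dw x * E x)) _ K _ _ _ x0)
    => y /andP[y0 _].
  rewrite -mulrN mulrCA ler_wpM2l ?(ltW (E0 _))//.
  by apply: le_trans (KE _ y0); rewrite -normrN ler_norm.
have Kx : K x <= 4 * M * E x.
  have := phi_ge x; rewrite -[leRHS]mul1r -ler_pdivrMr ?phi_gt0// => px.
  rewrite /K; have := E0 x; set r := _ / _ in px => Ex.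
  have -> : 4 * x * (phi x)^-1 = 2 * r by rewrite /r; field; exact: phi_neq0.
  by have := mulr_ge0 M0 (ltW Ex); nra.
have E1 : 1 <= E x by apply: le_trans (expR_ge1Dx _); rewrite lerDl divr_ge0 ?sqr_ge0.
have : `|dw x * E x| <= (`|dw 0| + 4 * M) * E x.
  rewrite ler_norml; have := ler_norm (dw 0); have := ler_norm (- dw 0).
  move: up lo; rewrite K0 Ee0 normrN.
  by have := normr_ge0 (dw 0); nra.
by rewrite normrM (gtr0_norm (E0 x)) ler_pM2r.
Qed.

End profile_equation.

(** * Explicit solutions of the linear profile equation *)

Section linear_problem.
Context {R : realType}.
Implicit Types (h v W : R -> R) (x M : R).

Fact gauss_primitive_subproof : exists N : R -> R,
  N 0 = 0 /\ forall x, is_derive x 1 N (expR (- (x ^+ 2 / 4))).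
Proof.
apply: exists_antiderivative => x.
by have : derivable (fun x : R => expR (- (x ^+ 2 / 4))) x 1 by [];
  move=> /derivable1_diffP/differentiable_continuous.
Qed.

(** This function is sqrt pi erf (x / 2). *)
Definition gauss_primitive : R -> R := projT1 (cid gauss_primitive_subproof).
Local Notation N := gauss_primitive.

Lemma gauss_primitive0 : N 0 = 0.
Proof. by case: (projT2 (cid gauss_primitive_subproof)). Qed.

Global Instance is_derive_gauss_primitive x :
  is_derive x 1 N (expR (- (x ^+ 2 / 4))).
Proof. by case: (projT2 (cid gauss_primitive_subproof)). Qed.

Lemma gauss_primitiveN x : N (- x) = - N x.
Proof.
apply: (@derive_eq _ (fun x => N (- x)) (fun x => - expR (- (x ^+ 2 / 4)))
  (fun x => - N x)) => [y|].
- have ? := is_derive_gauss_primitive (- y).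
  by apply: is_derive_eq; rewrite /GRing.scale/= sqrrN mulrN1.
- by rewrite oppr0 gauss_primitive0 oppr0.
Qed.

Lemma gauss_primitive_ge0 x : 0 <= x -> 0 <= N x.
Proof.
move=> x0; rewrite -gauss_primitive0.
by apply: (derive_ge0_le x0) => y _; exact: expR_ge0.
Qed.

Lemma gauss_primitive_le x y : x <= y -> N x <= N y.
Proof.
by move=> xy; apply: (derive_ge0_le xy) => z _; exact: expR_ge0.
Qed.

(** The substitution s = 2 y identifies the integral of e^{-y^2} over [0, b] with N (2 b) / 2, and
    the square of that integral tends to pi / 4. *)
Lemma gauss_primitive_lim (e : R) : 0 < e ->
  exists A, forall x, A <= x -> `|Num.sqrt pi - N x| <= e.
Proof.
move=> e0.
have E b : 0 < b -> gauss_integral_proof.integral0_gauss b = N (2 * b) / 2.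
  move=> b0; rewrite /gauss_integral_proof.integral0_gauss /Rintegral.
  have dF (y : R) : is_derive y 1 (fun x => N (2 * x) / 2) (gauss_fun y).
    have ? := is_derive_gauss_primitive (2 * y).
    apply: is_derive_eq; rewrite /GRing.scale/= /gauss_fun.
    rewrite (_ : (2 * y) ^+ 2 / 4 = y ^+ 2); by field.
  rewrite (@continuous_FTC2 _ _ (fun x => N (2 * x) / 2))//.
  - by rewrite /= mulr0 gauss_primitive0 mul0r subr0.
  - by apply: continuous_subspaceT; exact: continuous_gauss_fun.
  - split => [x _||]; first by case: (dF x).
    + exact/cvg_at_right_filter/(is_derive_continuous (dF 0)).
    + exact/cvg_at_left_filter/(is_derive_continuous (dF b)).
  - by move=> x _; rewrite derive1E; case: (dF x).
have : Num.sqrt (gauss_integral_proof.integral0_gauss x ^+ 2) @[x --> +oo]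
    --> Num.sqrt (pi / 4 : R).
  apply: continuous_cvg; first exact: sqrt_continuous.
  exact: gauss_integral_proof.cvg_integral0_gauss_sqr.
have -> : Num.sqrt (pi / 4 : R) = Num.sqrt pi / 2.
  rewrite sqrtrM ?pi_ge0// sqrtrV// (_ : 4 = 2 ^+ 2) ?sqrtr_sqr ?ger0_norm//.
  by ring.
move=> /cvgrPdist_le /(_ (e / 2)) []; first by rewrite divr_gt0.
move=> A [_ HA]; exists (2 * (`|A| + 1)) => x Ax.
have Ax2 : `|A| + 1 <= x / 2 by lra.
have x2 : 0 < x / 2 by apply: lt_le_trans Ax2; rewrite ltr_wpDl.
have /HA : A < x / 2.
  by apply: lt_le_trans Ax2; rewrite ltr_pwDr// ler_norm.
have e1 : `|gauss_integral_proof.integral0_gauss (x / 2)| = N x / 2.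
  rewrite ger0_norm ?gauss_integral_proof.integral0_gauss_ge0// E//.
  by rewrite mulrCA divff// mulr1.
by rewrite sqrtr_sqr/= e1 -mulrBl normrM [X in _ * X]gtr0_norm// ler_pM2r.
Qed.

Lemma gauss_primitive_le_sqrt_pi x : N x <= Num.sqrt pi.
Proof.
apply/ler_addgt0Pr => e /gauss_primitive_lim[A HA].
have := HA (Num.max A x); rewrite le_max lexx => /(_ isT).
have := gauss_primitive_le (_ : x <= Num.max A x).
rewrite le_max lexx orbT => /(_ isT).
by rewrite ler_distl; set y := N (Num.max _ _); move=> + /andP[]; lra.
Qed.

(** Closed form of the antiderivative of e^{-x^2/4} / phi^2 that vanishes at 0. By reduction of
    order [phi * psi] is a second homogeneous solution; [psi_oo] is the limit of [psi] at +oo. *)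
Definition psi x : R := (x * expR (- (x ^+ 2 / 4)) / phi x + N x / 2) / 4.

Definition psi_oo : R := Num.sqrt pi / 8.

Lemma psi_oo_gt0 : 0 < psi_oo.
Proof. by rewrite divr_gt0// sqrtr_gt0 pi_gt0. Qed.

Lemma is_derive_phi x : is_derive x 1 phi (2 * x).
Proof. by rewrite /phi; apply: is_derive_eq; rewrite /GRing.scale/=; ring. Qed.

Lemma is_derive_psi x :
  is_derive x 1 psi (expR (- (x ^+ 2 / 4)) / phi x ^+ 2).
Proof.
have ? := is_deriveV (phi_neq0 x) (is_derive_phi x).
rewrite /psi; apply: is_derive_eq; rewrite /GRing.scale/=.
have := phi_neq0 x; rewrite /phi => px; field.
by rewrite px.
Qed.

Lemma psi0 : psi 0 = 0.
Proof. by rewrite /psi gauss_primitive0 !mul0r add0r mul0r. Qed.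

Lemma psiN x : psi (- x) = - psi x.
Proof. by rewrite /psi /phi gauss_primitiveN sqrrN !mulNr -opprD mulNr. Qed.

(** This is the homogeneous solution in which the quadratic growth cancels; it can be added freely
    without leaving the scope of the comparison principle. *)
Lemma subquadratic_psi : subquadratic (fun x => phi x * (psi_oo - psi x)).
Proof.
move=> e e0; have e4 : 0 < 4 * e by rewrite mulr_gt0.
have [A HA] := gauss_primitive_lim e4.
exists (Num.max A (Num.max 1 (e^-1))) => x.
rewrite !ge_max => /and3P[Ax x1 ex]; have x0 : 0 < x by apply: lt_le_trans x1.
rewrite normrM (gtr0_norm (phi_gt0 x)) mulrC ler_wpM2r ?phi_ge0//.
have NA := HA _ Ax.
pose r := x * expR (- (x ^+ 2 / 4)) / phi x.
have r0 : 0 <= r by rewrite divr_ge0 ?phi_ge0// mulr_ge0 ?expR_ge0 ?ltW.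
have re : r <= e.
  rewrite ler_pdivrMr ?phi_gt0//; apply: (@le_trans _ _ x).
    by rewrite ler_piMr ?(ltW x0)// expR_le1 oppr_le0 divr_ge0 ?sqr_ge0.
  have : 1 <= e * x by rewrite -ler_pdivrMl// mulr1.
  by rewrite /phi; nra.
move: NA; rewrite !ler_distl /psi_oo /psi -/r => /andP[h1 h2].
by apply/andP; split; lra.
Qed.

(* If v' = W / P with P = phi^2 e^{x^2/4}, then w = phi v solves the equation
   with right-hand side h iff W' = - phi e^{x^2/4} h. *)
Lemma profile_eq_of_flux v W h :
  (forall x, is_derive x 1 v (W x * (expR (- (x ^+ 2 / 4)) / phi x ^+ 2))) ->
  (forall x, is_derive x 1 W (- (phi x * expR (x ^+ 2 / 4) * h x))) ->
  profile_eq (fun x => phi x * v x)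
    (fun x => 2 * x * v x + W x * (expR (- (x ^+ 2 / 4)) / phi x)) h.
Proof.
move=> dv dW x; have ? := dv x; have ? := dW x; have ? := is_derive_phi x.
have ? := is_deriveV (phi_neq0 x) (is_derive_phi x).
have px := phi_neq0 x; have ex : expR (x ^+ 2 / 4) != 0 by rewrite gt_eqF ?expR_gt0.
split; apply: is_derive_eq; rewrite /GRing.scale/= !expRN.
  by field; rewrite px.
set E := expR _ in ex *; rewrite /phi in px *.
by field; rewrite px.
Qed.

(** The constant solution 1 minus the multiple of phi (psi_oo - psi) that brings the value at 0 to
    0. Its slope there is phi(0) psi'(0) / (2 psi_oo) = (1/2) / (sqrt pi / 4) = 2 / sqrt pi. *)
Definition unit_profile x := 1 - phi x / 2 + phi x * psi x / (2 * psi_oo).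

Lemma unit_profileP : exists dw, [/\ profile_eq unit_profile dw (fun=> 1),
  dw 0 = 2 / Num.sqrt pi, unit_profile 0 = 0 & subquadratic unit_profile].
Proof.
have eq1 : @profile_eq R (fun=> 1) (fun=> 0) (fun=> 1).
  by move=> x; split; apply: is_derive_eq; rewrite ?mulr0 ?subr0 ?subrr.
have eqphi : profile_eq phi (fun x => 2 * x) (fun=> 0).
  move=> x; split; first exact: is_derive_phi.
  by apply: is_derive_eq; rewrite /GRing.scale/= /phi; field.
have eqpsi : profile_eq (fun x => phi x * psi x)
    (fun x => 2 * x * psi x + 1 * (expR (- (x ^+ 2 / 4)) / phi x)) (fun=> 0).
  apply: (@profile_eq_of_flux _ (fun=> 1)) => x.
    by rewrite mul1r; exact: is_derive_psi.
  by apply: is_derive_eq; rewrite mulr0 oppr0.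
have k0 := psi_oo_gt0.
have := profile_eq_lin 1 1 (profile_eq_lin 1 (- 2^-1) eq1 eqphi)
  (profile_eq_lin 0 (2 * psi_oo)^-1 eq1 eqpsi).
set w := fun x => _; set dw := fun x => _; set h := fun x => _ => eqw.
have wE : unit_profile = w.
  by apply/funext => x; rewrite /unit_profile /w; field; rewrite gt_eqF.
have hE : h = fun=> 1 by apply/funext => x; rewrite /h; ring.
exists dw; split.
- by rewrite wE -hE.
- have e0 : expR (- (0 ^+ 2 / 4)) = 1 :> R.
    by rewrite expr0n/= mul0r oppr0 expR0.
  rewrite /dw e0 psi0 /phi expr0n/= /psi_oo; field.
  by rewrite gt_eqF// sqrtr_gt0 pi_gt0.
- by rewrite /unit_profile psi0 /phi expr0n/=; lra.
- have -> : unit_profile = fun x =>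
      1 * 1 + - (2 * psi_oo)^-1 * (phi x * (psi_oo - psi x)).
    by apply/funext => x; rewrite /unit_profile; field; rewrite gt_eqF.
  apply: (@subquadratic_lin _ _ _ (fun=> 1)); last exact: subquadratic_psi.
  by apply: (@bounded_subquadratic _ _ 1) => x _; rewrite normr1.
Qed.

End linear_problem.

(** * Bounded odd solutions for bounded odd right-hand sides *)

Section bounded_solution.
Context {R : realType}.
Implicit Types (h w dw : R -> R) (x M : R).

(** A limit together with its rate of convergence. The index is an arbitrary total order because the
    lemma serves both for x in the reals and for a sequence of iterates. *)
Lemma sandwich_limit d (T : orderType d) (P : set T) (U V : T -> R) : P !=set0 ->
  {in P &, forall i j, (i <= j)%O -> U j <= U i} ->
  {in P &, forall i j, (i <= j)%O -> V i <= V j} ->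
  (forall i, P i -> V i <= U i) -> exists l, forall i, P i -> V i <= l <= U i.
Proof.
move=> [i0 Pi0] Un Vn VU.
have VUij i j : P i -> P j -> V i <= U j.
  move=> Pi Pj; have [ij|/ltW ji] := leP i j.
    by apply: le_trans (VU _ Pj); apply: Vn; rewrite ?inE.
  by apply: (le_trans (VU _ Pi)); apply: Un; rewrite ?inE.
have ubV j : P j -> ubound (V @` P) (U j) by move=> Pj _ [i Pi <-]; exact: VUij.
exists (sup (V @` P)) => i Pi; apply/andP; split.
  by apply: ub_le_sup; [exists (U i0); exact: ubV|exists i].
by apply: ge_sup; [exists (V i0); exists i0|exact: ubV].
Qed.

(** Reduction of order gives the odd solutions phi (a psi - Q). As Q tends to a limit l with error
    at most M / phi, the choice of a that cancels l leaves a subquadratic function, and comparison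
    with the constants M and -M then bounds it by M itself. This sharp constant keeps the later
    iterates in [-1, 1]. *)
Lemma exists_bounded_solution h M : continuous h ->
  (forall x, h (- x) = - h x) -> (forall x, `|h x| <= M) ->
  exists w dw, [/\ profile_eq w dw h, forall x, w (- x) = - w x
                 & forall x, `|w x| <= M].
Proof.
move=> ch oddh hM; have M0 := le_trans (normr_ge0 _) (hM 0).
have cphi : continuous (@phi R).
  by move=> x; exact: is_derive_continuous (is_derive_phi x).
have cexp (s : R) : continuous (fun x : R => expR (s * x ^+ 2)).
  move=> x; have : derivable (fun x : R => expR (s * x ^+ 2)) x 1 by [].
  by move=> /derivable1_diffP/differentiable_continuous.
have [I [I0 dI]] : exists I : R -> R, I 0 = 0 /\
    forall x, is_derive x 1 I (phi x * expR (4^-1 * x ^+ 2) * h x).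
  apply: exists_antiderivative => x.
  by apply: cvgM; [apply: cvgM; [exact: cphi|exact: cexp]|exact: ch].
have [Q [Q0 dQ]] : exists Q : R -> R, Q 0 = 0 /\
    forall x, is_derive x 1 Q (I x * (expR (- 4^-1 * x ^+ 2) / phi x ^+ 2)).
  apply: exists_antiderivative => x.
  apply: cvgM; first exact: is_derive_continuous (dI x).
  apply: cvgM; first exact: cexp.
  by apply: cvgV; [rewrite expf_neq0 ?phi_neq0|
    exact: (cvg_comp _ _ (cphi x) (@exprn_continuous _ 2 _))].
have Ieven x : I (- x) = I x.
  apply: (@derive_eq _ (fun x => I (- x))
      (fun x => phi x * expR (4^-1 * x ^+ 2) * h x)) => [y|]; last by rewrite oppr0.
  have ? := dI (- y); apply: is_derive_eq.
  by rewrite /GRing.scale/= /phi oddh !sqrrN mulrN1 mulrN opprK.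
have Qodd x : Q (- x) = - Q x.
  apply: (@derive_eq _ (fun x => Q (- x))
      (fun x => - (I x * (expR (- 4^-1 * x ^+ 2) / phi x ^+ 2)))
      (fun x => - Q x)) => [y|]; last by rewrite oppr0 Q0 oppr0.
  have ? := dQ (- y); apply: is_derive_eq.
  by rewrite /GRing.scale/= /phi Ieven !sqrrN mulrN1.
(* The majorant of |I| is explicit because (2 x e^{x^2/4})' = phi e^{x^2/4}. *)
pose J x : R := M * (2 * x * expR (4^-1 * x ^+ 2)).
have dJ (x : R) : is_derive x 1 J (M * (phi x * expR (4^-1 * x ^+ 2))).
  by apply: is_derive_eq; rewrite /GRing.scale/= /phi; field.
have IJ x : 0 <= x -> `|I x| <= J x.
  move=> x0.
  have hphi y : `|phi y * expR (4^-1 * y ^+ 2) * h y|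
      <= M * (phi y * expR (4^-1 * y ^+ 2)).
    have p0 : 0 <= phi y * expR (4^-1 * y ^+ 2).
      by rewrite mulr_ge0 ?phi_ge0 ?expR_ge0.
    by rewrite normrM (ger0_norm p0) mulrC ler_wpM2r.
  have J0 : J 0 = 0 by rewrite /J mulr0 mul0r mulr0.
  have up : I x - I 0 <= J x - J 0.
    by apply: (derive_le x0) => y _; apply: le_trans (hphi y); exact: ler_norm.
  have lo : - I x - - I 0 <= J x - J 0.
    apply: (@derive_le _ (fun x => - I x) _ J _ _ _ x0) => y _.
    by apply: le_trans (hphi y); rewrite -normrN ler_norm.
  by rewrite ler_norml; move: up lo; rewrite J0 I0; lra.
have IQ x : 0 <= x ->
    `|I x * (expR (- 4^-1 * x ^+ 2) / phi x ^+ 2)| <= M * (2 * x / phi x ^+ 2).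
  move=> x0; have p0 : 0 <= expR (- 4^-1 * x ^+ 2) / phi x ^+ 2.
    by rewrite divr_ge0 ?expR_ge0 ?sqr_ge0.
  rewrite normrM (ger0_norm p0); apply: le_trans (ler_wpM2r p0 (IJ _ x0)) _.
  rewrite /J mulNr expRN le_eqVlt; apply/orP; left; apply/eqP.
  by field; rewrite phi_neq0 gt_eqF ?expR_gt0.
have dV x : is_derive x 1 (fun x => M / phi x) (- (M * (2 * x / phi x ^+ 2))).
  have ? := is_deriveV (phi_neq0 x) (is_derive_phi x).
  apply: is_derive_eq; rewrite /GRing.scale/=; field.
  by rewrite phi_neq0.
(* By [IQ], |Q'| is at most minus the derivative of M / phi, so Q + M / phi decreases and Q - M /
   phi increases. *)
have [l lQ] : exists l, forall x, 0 <= x -> Q x - M / phi x <= l <= Q x + M / phi x.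
  apply: (@sandwich_limit _ R [set x | 0 <= x]) => [|x y|x y|x x0].
  - by exists 0 => /=.
  - rewrite !inE/= => x0 _ xy.
    have : Q y - Q x <= - (M / phi y) - - (M / phi x); last by lra.
    apply: (derive_le xy (fun z _ => dQ z) (fun z _ => is_deriveN (dV z))).
    move=> z /andP[xz _].
    have /IQ := le_trans x0 xz; rewrite ler_norml => /andP[_].
    by rewrite opprK.
  - rewrite !inE/= => x0 _ xy.
    have : M / phi y - M / phi x <= Q y - Q x; last by lra.
    apply: (derive_le xy (fun z _ => dV z) (fun z _ => dQ z)) => z /andP[xz _].
    by have /IQ := le_trans x0 xz; rewrite ler_norml => /andP[+ _].
  - have : 0 <= M / phi x by rewrite divr_ge0 ?phi_ge0.
    lra.
(* With this a the factor a psi - Q tends to 0 at +oo. *)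
pose a := l / psi_oo; have k0 := @psi_oo_gt0 R.
have eN x : expR (- (x ^+ 2 / 4)) = expR (- 4^-1 * x ^+ 2) :> R.
  by congr expR; field.
have eqw : profile_eq (fun x => phi x * (a * psi x - Q x))
    (fun x => 2 * x * (a * psi x - Q x)
              + (a - I x) * (expR (- (x ^+ 2 / 4)) / phi x)) h.
  apply: (@profile_eq_of_flux _ (fun x => a * psi x - Q x) (fun x => a - I x)) => x.
    have ? := dQ x; have ? := is_derive_psi x.
    by apply: is_derive_eq; rewrite /GRing.scale/= eN; ring.
  have ? := dI x; apply: is_derive_eq; rewrite (_ : x ^+ 2 / 4 = 4^-1 * x ^+ 2).
    by ring.
  by field.
set w := fun x => phi x * _ in eqw; set dw := fun x => _ in eqw.
have oddw x : w (- x) = - w x.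
  by rewrite /w psiN Qodd /phi sqrrN; ring.
have sw : subquadratic w.
  have -> : w = fun x =>
      - a * (phi x * (psi_oo - psi x)) + 1 * (phi x * (l - Q x)).
    by apply/funext => x; rewrite /w /a; field; rewrite gt_eqF.
  apply: subquadratic_lin; first exact: subquadratic_psi.
  apply: (@bounded_subquadratic _ _ M) => x x0.
  rewrite normrM (gtr0_norm (phi_gt0 x)) mulrC -ler_pdivlMr ?phi_gt0//.
  by have := lQ _ x0; rewrite ler_norml; lra.
have w0 : w 0 = 0 by rewrite /w psi0 Q0; ring.
have eqM : @profile_eq R (fun=> M) (fun=> 0) (fun=> M).
  by move=> x; split; apply: is_derive_eq; rewrite ?mulr0 ?subr0 ?subrr.
have sM : @subquadratic R (fun=> M).
  by apply: (@bounded_subquadratic _ _ M) => x _; rewrite ger0_norm.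
have wM x : 0 <= x -> `|w x| <= M.
  move=> x0; rewrite ler_norml; apply/andP; split.
    have := profile_eq_ge0 (profile_eq_lin 1 1 eqM eqw) _ _
      (subquadratic_lin 1 1 sM sw) x0; rewrite w0 !mul1r => H.
    rewrite -subr_ge0 opprK addrC; apply: H; last by rewrite addr0.
    by move=> y _; rewrite !mul1r; have := hM y; rewrite ler_norml; lra.
  have := profile_eq_ge0 (profile_eq_lin 1 (-1) eqM eqw) _ _
    (subquadratic_lin 1 (-1) sM sw) x0; rewrite w0 mul1r mulr0 addr0 mulN1r => H.
  rewrite -subr_ge0; apply: H => //.
  by move=> y _; have := hM y; rewrite ler_norml; nra.
exists w, dw; split => // x.
by have [/wM//|/ltW] := leP 0 x; rewrite -oppr_ge0 => /wM; rewrite oddw normrN.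
Qed.

End bounded_solution.

(** * The signed power and the profile nonlinearity for small exponents *)

Section signed_power.
Context {R : realType}.
Implicit Types (x y s w p : R).

Definition spow p x : R := Num.sg x * `|x| `^ p.

Lemma spowN p x : spow p (- x) = - spow p x.
Proof. by rewrite /spow sgrN normrN mulNr. Qed.

Lemma spow_ge0E p x : p != 0 -> 0 <= x -> spow p x = x `^ p.
Proof.
move=> p0; rewrite le_eqVlt => /predU1P[<-|x0].
  by rewrite /spow sgr0 mul0r powR0.
by rewrite /spow gtr0_sg// mul1r gtr0_norm.
Qed.

Lemma norm_spow p x : p != 0 -> `|spow p x| = `|x| `^ p.
Proof.
move=> p0; rewrite -(@spow_ge0E p `|x|)//.
have [x0|x0] := leP 0 x; rewrite ?(ger0_norm x0) ?(ltr0_norm x0).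
  by rewrite ger0_norm// spow_ge0E// powR_ge0.
by rewrite spowN -normrN -spowN ger0_norm// spow_ge0E ?powR_ge0// oppr_ge0 ltW.
Qed.

Lemma continuous_spow p : 0 < p -> continuous (spow p).
Proof.
move=> p0; have p_neq0 : p != 0 by rewrite gt_eqF.
have cpos x : 0 < x -> {for x, continuous (spow p)}.
  move=> x0; apply: (@is_derive_continuous R (spow p) x (p * x `^ (p - 1))).
  apply: (@near_eq_is_derive _ _ _ (fun y => y `^ p)); last exact: is_derive1_powR.
  near=> y; rewrite spow_ge0E//; apply/ltW; near: y; exact: lt_nbhsr.
move=> x; have [x0|x0|->] := ltgtP x 0; last first.
- apply/cvgrPdist_lt => e e0; near=> y.
  rewrite {1}/spow sgr0 mul0r sub0r normrN norm_spow//.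
  rewrite -(powRr1 (ltW e0)) -(mulVf p_neq0) powRrM.
  rewrite gt0_ltr_powR ?nnegrE ?powR_ge0//; near: y.
  by apply: (@cvgr0_norm_lt _ _ _ _ _ id) => //; rewrite powR_gt0.
- exact: cpos.
- have -> : spow p = fun x => - spow p (- x).
    by apply/funext => y; rewrite spowN opprK.
  apply: cvgN; apply: (cvg_comp (@GRing.opp R) (spow p)); first exact: opp_continuous.
  by apply: cpos; rewrite oppr_gt0.
Unshelve. all: by end_near. Qed.

(** The left side is y^p (1 - e^{-p ln (y/x)}), and 1 - e^{-s} <= s, ln (y/x) <= (y - x) / x. The
    factor p makes the Lipschitz constant relative to x small. *)
Lemma powR_sub_le p x y : 0 <= p -> 0 < x -> x <= y ->
  y `^ p - x `^ p <= p * y `^ p * (y - x) / x.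
Proof.
move=> p0 x0 xy; have y0 := lt_le_trans x0 xy.
rewrite {1 2 3}/powR !gt_eqF//; set b := expR (p * ln y).
have -> : expR (p * ln x) = b * expR (- (p * (ln y - ln x))).
  by rewrite /b -expRD; congr expR; ring.
have l1 : ln y - ln x <= (y - x) / x.
  rewrite -ln_div ?posrE// -[y / x](_ : 1 + (y - x) / x = _).
    by apply: le_ln1Dx; rewrite (lt_le_trans (ltrN10 _))// divr_ge0 ?subr_ge0// ltW.
  by field; rewrite gt_eqF.
have e1 := expR_ge1Dx (- (p * (ln y - ln x))).
have b0 : 0 < b by exact: expR_gt0.
have := ler_wpM2l p0 l1.
set L := p * (ln y - _) in e1 *; set r := p * (_ / _) => Lr.
have -> : p * b * (y - x) / x = b * r by rewrite /r; field; rewrite gt_eqF.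
nra.
Qed.

Lemma one_sub_powR_le p x : 0 < x -> 1 - x `^ p <= p * - ln x.
Proof.
move=> x0; rewrite /powR gt_eqF//.
by have := expR_ge1Dx (p * ln x); lra.
Qed.

(* The nonlinearity left after the self-similar substitution, where
   q = 1 / (1 - p) and q - 1 = p / (1 - p). *)
Definition source p x := spow p x - p / (1 - p) * x.

Lemma sourceN p x : source p (- x) = - source p x.
Proof. by rewrite /source spowN; ring. Qed.

Lemma continuous_source p : 0 < p -> continuous (source p).
Proof.
move=> p0 x; apply: cvgB; first exact: continuous_spow.
by apply: cvgMr; exact: cvg_id.
Qed.

Lemma drift_bounds p : 0 < p <= 3^-1 ->
  0 < p / (1 - p) /\ p / (1 - p) <= 2 * p /\ 2 * (p / (1 - p)) <= 1.
Proof.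
move=> /andP[p0 p3]; have p1 : 0 < 1 - p by lra.
split; first by rewrite divr_gt0.
by rewrite mulrA !ler_pdivrMr//; split; nra.
Qed.

Lemma source_bounds p w : 0 < p <= 3^-1 -> 0 <= w <= 1 ->
  w / 2 <= source p w <= 1.
Proof.
move=> hp /andP[w0 w1]; have [k0 [_ k2]] := drift_bounds hp.
case/andP: hp => p0 p3; rewrite /source spow_ge0E ?gt_eqF//.
move: w0; rewrite le_eqVlt => /predU1P[<-|w0]; first by rewrite powR0 ?gt_eqF//; lra.
have wp : w <= w `^ p by rewrite ger1_powR ?w0//; lra.
have wp1 : w `^ p <= 1.
  by rewrite -[leRHS](powRr0 w) ger_powR ?w0// ltW.
by apply/andP; split; nra.
Qed.

Lemma norm_source_le p w : 0 < p <= 3^-1 -> `|w| <= 1 -> `|source p w| <= 1.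
Proof.
move=> hp; wlog w0 : w / 0 <= w => [H w1|].
  have [/H/(_ w1)//|/ltW w0] := leP 0 w.
  by rewrite -normrN -sourceN H ?oppr_ge0 ?normrN.
rewrite ger0_norm// => w1; have w01 : 0 <= w <= 1 by rewrite w0.
by have /andP[] := source_bounds hp w01; rewrite ler_norml; lra.
Qed.

(** If w >= 2 s, the bound w / 2 suffices. Otherwise w <= 1/4, which is where s <= 1/8 enters, and
    w^p >= sqrt w >= 2 w. This makes the lower barrier invariant. *)
Lemma source_ge p s w : 0 < p <= 3^-1 -> 0 <= s <= 8^-1 -> s <= w <= 1 ->
  s <= source p w.
Proof.
move=> hp /andP[s0 s8] /andP[sw w1].
have w0 : 0 <= w := le_trans s0 sw.
have [w2|w2] := leP (2 * s) w.
  have w01 : 0 <= w <= 1 by rewrite w0.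
  by have /andP[] := source_bounds hp w01; lra.
have [k0 [_ k2]] := drift_bounds hp; case/andP: hp => p0 p3.
rewrite /source spow_ge0E ?gt_eqF//.
have wpos : 0 < w by lra.
have : 2 * w <= w `^ p.
  apply: (@le_trans _ _ (w `^ 2^-1)); last by rewrite ger_powR ?wpos//; lra.
  rewrite powR12_sqrt// -ler_sqr ?nnegrE ?sqrtr_ge0 ?mulr_ge0// sqr_sqrtr//.
  by rewrite expr2; nra.
nra.
Qed.

(** The slope of the power blows up like 1 / s, but the distance is measured in units of the common
    lower bound s. The power contributes p d and the linear term at most 2 p d. *)
Lemma source_lipschitz p s d x y : 0 < p <= 3^-1 -> 0 < s -> s <= x <= 1 ->
  s <= y <= 1 -> `|x - y| <= d * s -> `|source p x - source p y| <= 3 * p * d.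
Proof.
move=> hp s0; wlog xy : x y / x <= y => [H hx hy|].
  have [xy|/ltW yx] := leP x y; first exact: H.
  by rewrite distrC => D; rewrite distrC; exact: H.
move=> /andP[sx x1] /andP[sy y1]; have [k0 [k1 k2]] := drift_bounds hp.
case/andP: hp => p0 p3; have x0 := lt_le_trans s0 sx; have y0 := lt_le_trans s0 sy.
rewrite distrC ger0_norm ?subr_ge0// => D.
rewrite distrC /source !spow_ge0E ?(gt_eqF p0) ?(ltW x0) ?(ltW y0)//.
have pl := powR_sub_le (ltW p0) x0 xy.
have yp1 : y `^ p <= 1 by rewrite -[leRHS](powRr0 y) ger_powR ?y0// ltW.
have pm : x `^ p <= y `^ p by rewrite ge0_ler_powR ?nnegrE// ltW.
have d0 : 0 <= d.
  by rewrite -(pmulr_lge0 _ s0) (le_trans _ D)// subr_ge0.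
have rd : (y - x) / x <= d.
  by rewrite ler_pdivrMr// (le_trans D)// ler_wpM2l.
have yxd : y - x <= d by apply: (le_trans D); rewrite ler_piMr//; lra.
have {pl} : y `^ p - x `^ p <= p * d.
  apply: (le_trans pl); rewrite -mulrA -[leLHS]mulrA ler_wpM2l ?(ltW p0)//.
  apply: (@le_trans _ _ (1 * ((y - x) / x))); last by rewrite mul1r.
  by rewrite ler_wpM2r// divr_ge0 ?subr_ge0// ltW.
set k := p / _ in k0 k1 k2 *.
rewrite ler_norml; set Y := y `^ p in pm *; set X := x `^ p in pm *.
move=> YX; have kd : k * (y - x) <= 2 * p * d.
  by apply: ler_pM; rewrite ?subr_ge0// ltW.
have kd0 : 0 <= k * (y - x) by rewrite mulr_ge0 ?subr_ge0// ltW.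
by apply/andP; split; nra.
Qed.

(** Quantifies the convergence of the right-hand side to 1 as p tends to 0, uniformly where w stays
    above a fixed s. *)
Lemma source_defect p s w : 0 < p <= 3^-1 -> 0 < s -> s <= w <= 1 ->
  1 - source p w <= p * (2 - ln s).
Proof.
move=> hp s0 /andP[sw w1]; have [k0 [k1 k2]] := drift_bounds hp.
case/andP: hp => p0 p3; have w0 := lt_le_trans s0 sw.
rewrite /source spow_ge0E ?gt_eqF ?(ltW w0)//.
have := one_sub_powR_le p w0; have : ln s <= ln w by rewrite ler_ln ?posrE.
by set k := p / _ in k0 k1 k2 *; nra.
Qed.

End signed_power.

(** * The lower barrier and distances weighted by it *)

Section fixed_point.
Context {R : realType}.
Implicit Types (w dw h : R -> R) (x p : R) (n : nat).
Local Notation N := gauss_primitive.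

Lemma sqrt_pi_bounds : 1 <= Num.sqrt (pi : R) <= 2.
Proof.
have p2 := @pi_ge2 R; have p4 : (pi : R) <= 4 by have := @pihalf_lt2 R; lra.
rewrite -[X in X <= _ <= _]sqrtr1 ler_sqrt ?pi_gt0//.
rewrite -(ler_sqr (sqrtr_ge0 _)) ?nnegrE// sqr_sqrtr ?pi_ge0//.
  by apply/andP; split; rewrite ?expr2; lra.
exact: pi_ge0.
Qed.

(* N solves the equation with right-hand side N, which makes a small multiple
   of it a lower barrier for the nonlinear problem. *)
Definition barrier x : R := N x / 16.

Lemma barrierN x : barrier (- x) = - barrier x.
Proof. by rewrite /barrier gauss_primitiveN mulNr. Qed.

Lemma profile_eq_barrier : exists dw, profile_eq barrier dw barrier.
Proof.
exists (fun x => expR (- (x ^+ 2 / 4)) / 16) => x.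
have ? := is_derive_gauss_primitive x.
rewrite /barrier; split; apply: is_derive_eq; rewrite /GRing.scale/=.
  by field.
by field.
Qed.

(** The divisor 16 is chosen for this: N <= sqrt pi <= 2 gives 1/8, the threshold of [source_ge]. *)
Lemma barrier_bounds x : 0 <= x -> 0 <= barrier x <= 8^-1.
Proof.
move=> x0; have := gauss_primitive_ge0 x0.
have := gauss_primitive_le_sqrt_pi x; have /andP[_] := sqrt_pi_bounds.
by rewrite /barrier; set y := Num.sqrt _; lra.
Qed.

Lemma norm_barrier x : 0 <= x -> `|barrier x| = barrier x.
Proof. by move=> /barrier_bounds/andP[b0 _]; rewrite ger0_norm. Qed.

(** On [0, 1] the integrand e^{-s^2/4} is at least 3/4, and 64/3 is 16 divided by 3/4. *)
Lemma barrier_ge x : 0 <= x -> Num.min x 1 <= 64 / 3 * barrier x.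
Proof.
have H (y : R) : 0 <= y -> y <= 1 -> 3 / 4 * y <= N y.
  move=> y0 y1; have d34 (z : R) : is_derive z 1 (fun z => 3 / 4 * z) (3 / 4).
    by apply: is_derive_eq; rewrite /GRing.scale/=; ring.
  have := derive_le y0 (fun z _ => d34 z) (fun z _ => is_derive_gauss_primitive z).
  rewrite gauss_primitive0 mulr0 !subr0; apply => z /andP[z0 zy].
  apply: le_trans (expR_ge1Dx _).
  have : z ^+ 2 <= 1 by rewrite expr_le1// (le_trans zy).
  lra.
move=> x0; rewrite /barrier; have [x1|x1] := leP x 1.
  by have := H _ x0 x1; lra.
by have := H 1 ler01 (lexx _); have := gauss_primitive_le (ltW x1); lra.
Qed.

Lemma barrier_gt0 x : 0 < x -> 0 < barrier x.
Proof.
move=> x0; rewrite -(pmulr_lgt0 _ (_ : 0 < 64 / 3)); last by lra.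
rewrite mulrC; apply: lt_le_trans (barrier_ge (ltW x0)).
by rewrite lt_min x0 ltr01.
Qed.

(** A comparison function vanishing at 0: b = 1 serves for distances between solutions, large b for
    a boundary layer at the origin. *)
Lemma profile_eq_exp (b : R) : profile_eq (fun x => 1 - expR (- b * x))
  (fun x => b * expR (- b * x))
  (fun x => 1 + (b ^+ 2 - 1 - b * x / 2) * expR (- b * x)).
Proof. by move=> x; split; apply: is_derive_eq; rewrite /GRing.scale/=; field. Qed.

Lemma mul_expRN_le1 x : x * expR (- x) <= 1.
Proof.
rewrite expRN ler_pdivrMr ?expR_gt0// mul1r.
by apply: le_trans (expR_ge1Dx _); rewrite lerDr.
Qed.

(* Comparison with 2 (1 - e^{-x}), whose right-hand side is at least 1 for x >= 0. *)
Lemma profile_eq_dist w1 dw1 h1 w2 dw2 h2 (c M : R) :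
  profile_eq w1 dw1 h1 -> profile_eq w2 dw2 h2 -> w1 0 = w2 0 ->
  (forall x, 0 <= x -> `|w1 x| <= M) -> (forall x, 0 <= x -> `|w2 x| <= M) ->
  (forall x, 0 <= x -> `|h1 x - h2 x| <= c) ->
  forall x, 0 <= x -> `|w1 x - w2 x| <= 43 * c * barrier x.
Proof.
move=> eq1 eq2 w0 wM1 wM2 hc x x0; have c0 := le_trans (normr_ge0 _) (hc 0 (lexx _)).
have eqB := profile_eq_exp 1.
have sB : subquadratic (fun x => 1 - expR (- 1 * x) : R).
  apply: (@bounded_subquadratic _ _ 1) => y y0; have e0 := expR_gt0 (- 1 * y).
  have e1 : expR (- 1 * y) <= 1 by rewrite expR_le1 mulN1r oppr_le0.
  by rewrite ger0_norm; lra.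
have s1 := bounded_subquadratic wM1; have s2 := bounded_subquadratic wM2.
have key (s : R) : `|s| = 1 -> s * (w1 x - w2 x) <= 2 * c * (1 - expR (- 1 * x)).
  move=> s1E.
  have := profile_eq_ge0 (profile_eq_lin 1 1 (profile_eq_lin (2 * c) (- s) eqB eq1)
      (profile_eq_lin 0 s eqB eq2)) _ _
    (subquadratic_lin 1 1 (subquadratic_lin (2 * c) (- s) sB s1)
      (subquadratic_lin 0 s sB s2)) x0.
  rewrite /= w0 => H.
  have : 0 <= 1 * (2 * c * (1 - expR (-1 * x)) + - s * w1 x) +
        1 * (0 * (1 - expR (-1 * x)) + s * w2 x); last by lra.
  apply: H => [y y0|]; last by rewrite mulr0 expR0 subrr; lra.
  have hs : s * (h1 y - h2 y) <= c.
    by apply: le_trans (hc _ y0); apply: (le_trans (ler_norm _)); rewrite normrM s1E mul1r.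
  by have := ler_wpM2l c0 (mul_expRN_le1 y); rewrite mulN1r; lra.
have up := key 1 (normr1 _); have lo := key (-1) (normrN1 _).
(* Since 1 - e^{-x} <= min(x, 1), [barrier_ge] gives the factor 2 * 64/3 = 128/3 < 43. *)
have B43 : 2 * c * (1 - expR (- 1 * x)) <= 43 * c * barrier x.
  rewrite -!mulrA -[leLHS]mulrCA -[leRHS]mulrCA ler_wpM2l//.
  have := barrier_ge x0; have := expR_ge1Dx (- 1 * x); have := expR_gt0 (- 1 * x).
  have /andP[b0 _] := barrier_bounds x0.
  by rewrite /Num.min; case: ifP => _; lra.
by rewrite ler_norml; lra.
Qed.

End fixed_point.

(** * Existence of the nonlinear profile by a weighted contraction *)

Section nonlinear_profile.
Context {R : realType}.
Implicit Types (w dw h : R -> R) (x p : R) (n : nat).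

Lemma le0_of_le_geometric (a C : R) : (forall n, a <= C * 2^-1 ^+ n) -> a <= 0.
Proof.
move=> aC; have := @cvg_geometric R C 2^-1.
rewrite ger0_norm// => /(_ _)/cvgr_to_ge; apply; first lra.
by apply: nearW => n; exact: aC.
Qed.

Lemma odd0 w : (forall x, w (- x) = - w x) -> w 0 = 0.
Proof. by move=> /(_ 0); rewrite oppr0; lra. Qed.

Definition profile_class w :=
  [/\ continuous w, forall x, w (- x) = - w x
    & forall x, 0 <= x -> barrier x <= w x <= 1].

Lemma profile_class_norm w x : profile_class w -> `|w x| <= 1.
Proof.
move=> [_ wodd wb]; wlog x0 : x / 0 <= x => [H|].
  have [/H//|/ltW x0] := leP 0 x.
  by rewrite -normrN -wodd H ?oppr_ge0.
have /andP[b0 _] := barrier_bounds x0.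
by have /andP[bw w1] := wb _ x0; rewrite ger0_norm// (le_trans b0).
Qed.

Lemma profile_class_barrier : profile_class barrier.
Proof.
split=> [x|x|x x0]; first 1 last.
- exact: barrierN.
- by have := barrier_bounds x0; lra.
- have [dw eqb] := @profile_eq_barrier R; have [db _] := eqb x.
  exact: is_derive_continuous db.
Qed.

(** The upper bound comes from the linear problem with M = 1. For the lower one, [barrier] is its
    own right-hand side and lies below [source p \o w] by [source_ge]. *)
Lemma exists_profile_step p w : 0 < p <= 3^-1 -> profile_class w ->
  exists w' dw', profile_class w' /\ profile_eq w' dw' (source p \o w).
Proof.
move=> hp cw; have [wc wodd wb] := cw; have p0 : 0 < p by case/andP: hp.
have wn x := profile_class_norm x cw.
have [|x|x|w' [dw' [eqw' oddw' w'1]]] :=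
    @exists_bounded_solution R (source p \o w) 1.
- by move=> x; apply: continuous_comp; [exact: wc|exact: continuous_source].
- by rewrite /= wodd sourceN.
- exact: norm_source_le.
exists w', dw'; split => //; split => // [x|x x0].
  by have [dx _] := eqw' x; exact: is_derive_continuous dx.
have [db eqb] := @profile_eq_barrier R.
have := profile_eq_ge0 (profile_eq_lin 1 (-1) eqw' eqb) _ _
  (subquadratic_lin 1 (-1) (bounded_subquadratic (fun x _ => w'1 x))
    (bounded_subquadratic (fun x _ => profile_class_norm x profile_class_barrier))) x0.
rewrite /= (odd0 oddw') (odd0 barrierN) => H.
have w1 := le_trans (ler_norm _) (w'1 x); apply/andP; split => //.
suff : 0 <= 1 * w' x + -1 * barrier x by lra.
apply: H => [y y0|]; last by rewrite !mulr0 addr0.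
have := source_ge hp (barrier_bounds y0) (wb _ y0); lra.
Qed.

(** The constants 3 p of [source_lipschitz], with s the value of [barrier] at the point, and 43 of
    [profile_eq_dist] multiply to 129 p <= 1/2. *)
Lemma profile_step_contraction p w1 w1' dw1 w2 w2' dw2 (d : R) :
  0 < p <= 3^-1 -> 129 * p <= 2^-1 -> profile_class w1 -> profile_class w2 ->
  profile_class w1' -> profile_class w2' ->
  profile_eq w1' dw1 (source p \o w1) -> profile_eq w2' dw2 (source p \o w2) ->
  (forall x, 0 <= x -> `|w1 x - w2 x| <= d * barrier x) ->
  forall x, 0 <= x -> `|w1' x - w2' x| <= d / 2 * barrier x.
Proof.
move=> hp p129 c1 c2 c1' c2' eq1 eq2 wd x x0.
have [_ odd1 b1] := c1; have [_ odd2 b2] := c2.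
have [_ odd1' _] := c1'; have [_ odd2' _] := c2'.
have d0 : 0 <= d.
  have b := barrier_gt0 (ltr01 : (0 : R) < 1); rewrite -(pmulr_lge0 _ b).
  exact: le_trans (wd 1 ler01).
have p0 : 0 <= p by case/andP: hp => /ltW.
have H y : 0 <= y -> `|(source p \o w1) y - (source p \o w2) y| <= 3 * p * d.
  rewrite le_eqVlt => /predU1P[<-|y0] /=.
    by rewrite (odd0 odd1) (odd0 odd2) subrr normr0 !mulr_ge0.
  have y0' := ltW y0.
  by apply: source_lipschitz (barrier_gt0 y0) _ _ _ => //; [exact: b1|exact: b2|exact: wd].
apply: le_trans (profile_eq_dist eq1 eq2 _ _ _ H x0) _.
- by rewrite (odd0 odd1') (odd0 odd2').
- by move=> y _; exact: profile_class_norm c1'.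
- by move=> y _; exact: profile_class_norm c2'.
- have /andP[b0 _] := barrier_bounds x0.
  have -> : 43 * (3 * p * d) = 129 * p * d by ring.
  by rewrite ler_wpM2r// mulrC ler_wpM2l.
Qed.

(** Picard iteration from [barrier]. The differential equation is not passed to the limit: the step
    is applied once more to the limit w, and the contraction shows that its image is w. *)
Lemma exists_profile p : 0 < p -> 129 * p <= 2^-1 ->
  exists w dw, profile_class w /\ profile_eq w dw (source p \o w).
Proof.
move=> p0 p129; have hp : 0 < p <= 3^-1 by rewrite p0; lra.
have /choice[K HK] : forall w, exists w', profile_class w ->
    profile_class w' /\ exists dw', profile_eq w' dw' (source p \o w).
  move=> w; have [cw|ncw] := pselect (profile_class w); last by exists w => /ncw.
  have [w' [dw' [cw' eqw']]] := exists_profile_step hp cw.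
  by exists w' => _; split => //; exists dw'.
pose u n := iter n K barrier.
have cu n : profile_class (u n).
  elim: n => [|n IH]; first exact: profile_class_barrier.
  by have [] := HK _ IH.
have equ n : exists dw, profile_eq (u n.+1) dw (source p \o u n).
  by have [] := HK _ (cu n).
have unorm n x : `|u n x| <= 1 := profile_class_norm x (cu n).
have uodd n x : u n (- x) = - u n x by have [] := cu n.
(* 86 = 43 * 2: the right-hand sides of the first two iterates differ by at most 2. *)
have step n x : 0 <= x -> `|u n.+1 x - u n x| <= 86 * 2^-1 ^+ n * barrier x.
  elim: n x => [|n IH] x x0.
    have [dw eq1] := equ 0; have [db eqb] := @profile_eq_barrier R.
    rewrite expr0 mulr1 (_ : 86 = 43 * 2 :> R); last by ring.
    apply: (profile_eq_dist eq1 eqb _ (fun y _ => unorm 1 y) (fun y _ => unorm 0 y)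
      _ x0) => [|y y0].
      by rewrite (odd0 (uodd 1)) (odd0 barrierN).
    apply: (le_trans (ler_normB _ _)); have := norm_source_le hp (unorm 0 y).
    by have := unorm 0 y; rewrite /u/=; lra.
  have [d1 eq1] := equ n.+1; have [d2 eq2] := equ n.
  have := profile_step_contraction hp p129 (cu n.+1) (cu n) (cu n.+2) (cu n.+1) eq1 eq2 IH x0.
  by rewrite exprSr mulrA.
have step' n x : `|u n.+1 x - u n x| <= 86 * 2^-1 ^+ n * `|barrier x|.
  have [x0|/ltW] := leP 0 x; first by rewrite norm_barrier// step.
  rewrite -oppr_ge0 => x0.
  rewrite -[`|barrier x|]normrN -barrierN norm_barrier//.
  by have := step n _ x0; rewrite !uodd -opprD normrN.
(* 172 = 2 * 86 sums the geometric tail: [u n x + c n] decreases and [u n x - c n] increases in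
   n. *)
have /choice[w wu] : forall x, exists l, forall n,
    `|l - u n x| <= 172 * 2^-1 ^+ n * `|barrier x|.
  move=> x; pose c n : R := 172 * 2^-1 ^+ n * `|barrier x|.
  have cS n : c n - c n.+1 = 86 * 2^-1 ^+ n * `|barrier x|.
    by rewrite /c exprS; field.
  have [|i j _ _|i j _ _|n _|l Hl] :=
    @sandwich_limit R _ nat setT (fun n => u n x + c n) (fun n => u n x - c n).
  - by exists 0%N.
  - move: i j; apply/nonincreasing_seqP => n.
    by have := step' n x; rewrite -cS ler_norml; lra.
  - move: i j; apply/nondecreasing_seqP => n.
    by have := step' n x; rewrite -cS ler_norml; lra.
  - have : 0 <= c n by rewrite !mulr_ge0// exprn_ge0.
    lra.
  - by exists l => n; have := Hl n I; rewrite -/(c n) ler_norml; lra.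
have bn x : `|barrier x| <= 1 := profile_class_norm x profile_class_barrier.
have wu1 x n : `|w x - u n x| <= 172 * 2^-1 ^+ n.
  apply: (le_trans (wu x n)); by rewrite ler_piMr// mulr_ge0// exprn_ge0.
have wodd x : w (- x) = - w x.
  apply/eqP; rewrite -subr_eq0 -normr_eq0 eq_le normr_ge0 andbT.
  apply: (@le0_of_le_geometric _ 344) => n.
  have := wu1 x n; have := wu1 (- x) n; rewrite uodd !ler_norml; lra.
have wc : continuous w.
  move=> x; apply/cvgrPdist_lt => e e0.
  have [n Hn] : exists n, 172 * 2^-1 ^+ n < e / 3.
    apply/not_existsP => H; have /= := @le0_of_le_geometric (e / 3) 172.
    move=> /(_ (fun n => _)) HH; suff : e / 3 <= 0 by lra.
    by apply: HH => n; rewrite leNgt; apply/negP/H.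
  have [uc _ _] := cu n; have e3 : 0 < e / 3 by lra.
  near=> y; have : `|u n x - u n y| < e / 3.
    near: y; move: (uc x) => /cvgrPdist_lt; exact.
  by have := wu1 x n; have := wu1 y n; rewrite !ltr_norml !ler_norml; lra.
have cw : profile_class w.
  split=> // x x0; have hn n : barrier x <= u n x <= 1 by have [_ _ H] := cu n; exact: H.
  apply/andP; split; rewrite -subr_le0; apply: (@le0_of_le_geometric _ 172) => n.
    by have := wu1 x n; have := hn n; rewrite ler_norml; lra.
  by have := wu1 x n; have := hn n; rewrite ler_norml; lra.
have [w' [dw' [cw' eqw']]] := exists_profile_step hp cw.
have [_ wodd' _] := cw'.
have wE x : 0 <= x -> w x = w' x.
  move=> x0; apply/eqP; rewrite -subr_eq0 -normr_eq0 eq_le normr_ge0 andbT.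
  apply: (@le0_of_le_geometric _ 172) => n; have [d eqn] := equ n.
  have wun y : 0 <= y -> `|w y - u n y| <= 172 * 2^-1 ^+ n * barrier y.
    by move=> y0; have := wu y n; rewrite norm_barrier.
  have := profile_step_contraction hp p129 cw (cu n) cw' (cu n.+1) eqw' eqn wun x0.
  have := wu1 x n.+1; have /andP[b0 b1] := barrier_bounds x0.
  rewrite exprS; have : 0 <= 2^-1 ^+ n :> R by rewrite exprn_ge0.
  set r := 2^-1 ^+ n; set W := w x; set W' := w' x; set v := u n.+1 x.
  by rewrite !ler_norml => r0; nra.
have e : w = w'.
  apply/funext => x; have [/wE//|/ltW] := leP 0 x.
  by rewrite -oppr_ge0 => /wE; rewrite wodd wodd'; lra.
by exists w, dw'; split => //; move: eqw'; rewrite -e.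
Unshelve. all: by end_near. Qed.

End nonlinear_profile.

(** * Profiles whose slope at the origin is close to 2 / sqrt pi *)

Section steep_profile.
Context {R : realType}.
Implicit Types (w dw z dz h : R -> R) (x p e : R).

Lemma profile_eq_deriv_ge0 z dz h : profile_eq z dz h -> z 0 = 0 ->
  (forall x, 0 <= x -> 0 <= z x) -> 0 <= dz 0.
Proof.
move=> eqz z0 zge0; rewrite leNgt; apply/negP => dz0.
have [_ /is_derive_continuous dzc] := eqz 0.
have : \forall y \near (0 : R), dz y < 0 by exact: cvgr_lt dzc _ dz0.
move=> [d /= d0 Hd].
have d2 : 0 < d / 2 by rewrite divr_gt0.
have [c /andP[c0 cd] e] := mean_value (ltW d2) (fun y _ => (eqz y).1).
have : 0 <= dz c * (d / 2).
  by move: e; rewrite z0 !subr0 => <-; exact/zge0/ltW.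
rewrite pmulr_lge0// leNgt Hd//= sub0r normrN ger0_norm//.
by apply: (le_lt_trans cd); rewrite ltr_pdivrMr// ltr_pMr// ltr1n.
Qed.

(** The function (1 - e/4) [unit_profile] - k (1 - e^{-b x}) vanishes at 0 and is shown to lie below
    w, so its slope bounds [dw 0] from below. The factor 1 - e/4 pays for the defect of the source
    away from 0, the boundary layer pays near 0, where w is small. Each correction costs at most e/2
    in slope. *)
Lemma exists_steep_profile e : 0 < e -> exists p w dw,
  [/\ 0 < p <= 258^-1, profile_class w, profile_eq w dw (source p \o w)
    & 2 / Num.sqrt pi - e <= dw 0].
Proof.
move=> e0; pose b : R := 2 + 12 / e.
have b2 : 2 <= b by rewrite lerDl divr_ge0// ltW.
have be : 12 <= b * e by rewrite /b mulrDl divfK ?gt_eqF//; lra.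
have b1 : 0 < b ^+ 2 - 1 by nra.
(* This makes the right-hand side of k (1 - e^{-b x}) at least 3 e^{-b x}, while its slope k b is
   small because b is large. *)
pose k := 3 / (b ^+ 2 - 1).
have k0 : 0 < k by rewrite divr_gt0.
have kb : k * (b ^+ 2 - 1) = 3 by rewrite /k divfK// gt_eqF.
have kbe : k * b <= e / 2 by rewrite /k mulrAC ler_pdivrMr//; nra.
(* The lower bound (3/64) min(x, 1) of [barrier], taken at x = 1 / (3 b). *)
pose s : R := 64^-1 / b; have b0 : 0 < b by lra.
have s0 : 0 < s by rewrite divr_gt0.
have lns : 0 < 2 - ln s.
  have : ln s <= 0.
    by apply: ln_le0; rewrite /s ler_pdivrMr//; lra.
  by lra.
(* The first bound is the contraction condition 129 p <= 1/2, the second makes the defect at height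
   s at most e/4. *)
pose p := Num.min (258^-1) (e / 4 / (2 - ln s)).
have p0 : 0 < p by rewrite lt_min; apply/andP; split; [lra|rewrite !divr_gt0].
have p258 : p <= 258^-1 by rewrite ge_min lexx.
have hp : 0 < p <= 3^-1 by rewrite p0; lra.
have pe : p * (2 - ln s) <= e / 4 by rewrite -ler_pdivlMr// ge_min lexx orbT.
have p129 : 129 * p <= 2^-1 by lra.
have [w [dw [cw eqw]]] := exists_profile p0 p129.
exists p, w, dw; split=> //; first by rewrite p0.
have [_ wodd wb] := cw; have wn x := profile_class_norm x cw.
have [dw0 [eq0 dw00 w00 s0']] := @unit_profileP R.
have eqY := profile_eq_exp b.
have sY : subquadratic (fun x => 1 - expR (- b * x) : R).
  apply: (@bounded_subquadratic _ _ 1) => y y0; have e1 := expR_gt0 (- b * y).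
  have e2 : expR (- b * y) <= 1.
    by rewrite expR_le1 mulNr oppr_le0 mulr_ge0// ltW.
  by rewrite ger0_norm; lra.
have eqZ := profile_eq_lin 1 1 (profile_eq_lin (e / 4 - 1) k eq0 eqY) eqw.
have sZ := subquadratic_lin 1 1 (subquadratic_lin (e / 4 - 1) k s0' sY)
  (bounded_subquadratic (fun x _ => wn x)).
have eb0 : expR (- b * 0) = 1 by rewrite mulr0 expR0.
have z0 : 1 * ((e / 4 - 1) * unit_profile 0 + k * (1 - expR (- b * 0))) + 1 * w 0 = 0.
  by rewrite w00 (odd0 wodd) eb0; ring.
have := profile_eq_deriv_ge0 eqZ z0 (profile_eq_ge0 eqZ _ _ sZ).
rewrite z0 dw00 eb0 (mulr1 b) => H.
have {H} : 0 <= 1 * ((e / 4 - 1) * (2 / Num.sqrt pi) + k * b) + 1 * dw 0.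
  apply: H => // x x0 /=.
  set E := expR (- b * x).
  have E0 : 0 < E by exact: expR_gt0.
  have xE : b * x * E <= 1 by rewrite /E mulNr mul_expRN_le1.
  have key : 3 * E <= k * (1 + (b ^+ 2 - 1 - b * x / 2) * E).
    have -> : k * (1 + (b ^+ 2 - 1 - b * x / 2) * E)
        = k * (b ^+ 2 - 1) * E + k * (1 - b * x * E / 2) by field.
    by rewrite kb lerDl mulr_ge0 ?(ltW k0)//; lra.
  suff : 1 - source p (w x) <= e / 4 + 3 * E by lra.
  (* For b x <= 1/3 one has 3 E >= 2, which absorbs any defect of a source bounded by 1; beyond, w
     >= s and the defect is at most e/4. *)
  have [xb|bx] := leP (b * x) 3^-1.
    have := norm_source_le hp (wn x); rewrite ler_norml => /andP[h1 _].
    have := expR_ge1Dx (- b * x); rewrite -/E; lra.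
  apply: (@le_trans _ _ (e / 4)); last by rewrite lerDl mulr_ge0// ltW.
  apply: le_trans pe; apply: (source_defect hp s0).
  have /andP[bw w1] := wb _ x0; rewrite w1 andbT; apply: le_trans bw.
  have := barrier_ge x0; have : (3 * b)^-1 <= Num.min x 1.
    rewrite le_min; apply/andP; split.
      by rewrite invfM ler_pdivrMr// mulrC ltW.
    by rewrite invf_le1; lra.
  rewrite /s invfM; lra.
have /andP[sp1 sp2] := @sqrt_pi_bounds R.
have : 2 / Num.sqrt pi <= 2 :> R.
  by rewrite ler_pdivrMr ?(lt_le_trans _ sp1)//; lra.
have : 0 <= 2 / Num.sqrt pi :> R by rewrite divr_ge0// sqrtr_ge0.
set S := 2 / _; nra.
Qed.

End steep_profile.

(** * The singular integral of 1 / sqrt (t - tau) *)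

Section abel_integral.
Context {R : realType}.

(* For nonnegative functions the integral is a supremum over the simple
   functions below, whence monotonicity without measurability. *)
Lemma ge0_le_integral_sup d (T : measurableType d) (mu : measure T R) (D : set T)
    (f g : T -> \bar R) : (forall x, D x -> 0 <= f x <= g x)%E ->
  (\int[mu]_(x in D) f x <= \int[mu]_(x in D) g x)%E.
Proof.
move=> fg; rewrite (integral_mkcond D f) (integral_mkcond D g).
have fgD x : (0 <= (f \_ D) x <= (g \_ D) x)%E.
  by rewrite !patchE; case: ifPn => [/set_mem/fg//|_]; rewrite lexx.
rewrite !ge0_integralTE => [|x|x]; first 1 last.
- by have /andP[f0 gf] := fgD x; exact: le_trans gf.
- by have /andP[] := fgD x.
apply: ereal_sup_le => _ [h hf <-].
by exists h => // x; apply: (le_trans (hf x)); have /andP[] := fgD x.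
Qed.

Lemma continuous_inv_sqrt (t x : R) : x < t ->
  {for x, continuous (fun x => (Num.sqrt (t - x))^-1)}.
Proof.
move=> xt; apply: cvgV; first by rewrite gt_eqF// sqrtr_gt0 subr_gt0.
apply: (@continuous_comp _ _ _ (fun x => t - x) Num.sqrt); last exact: sqrt_continuous.
by apply: cvgB; [exact: cvg_cst|exact: cvg_id].
Qed.

Lemma measurable_inv_sqrt (t : R) :
  measurable_fun (`[0, t[%classic : set (measurableTypeR R))
    (fun x => ((Num.sqrt (t - x))^-1)%:E).
Proof.
apply/measurable_EFinP.
apply: subspace_continuous_measurable_fun; first exact: measurable_itv.
apply: continuous_in_subspaceT => x; rewrite inE/= in_itv/= => /andP[_].
exact: continuous_inv_sqrt.
Qed.

(** The antiderivative -2 sqrt (t - tau) is not differentiable at tau = t, so it is used on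
    [0, t - t / (n + 2)], followed by monotone convergence. The offset 2 keeps the first interval
    nondegenerate. *)
Lemma integral_inv_sqrt_le (t : R) : 0 < t ->
  (\int[lebesgue_measure]_(tau in `[0%R, t[) ((Num.sqrt (t - tau))^-1)%:E
    <= (2 * Num.sqrt t)%:E)%E.
Proof.
move=> t0; pose b n : R := t - t / n.+2%:R.
have bt n : b n < t by rewrite /b ltrBlDr ltrDl divr_gt0.
have b0 n : 0 < b n.
  by rewrite /b subr_gt0 ltr_pdivrMr// ltr_pMr// ltr1n.
have bS n : b n <= b n.+1.
  by rewrite /b lerD2l lerN2 ler_wpM2l ?(ltW t0)// lef_pV2 ?posrE// ler_nat.
have UE : `[0%R, t[%classic = \bigcup_n `[0%R, b n]%classic.
  apply/seteqP; split => [x|x [n _]] /=; rewrite !in_itv/= => /andP[x0 xt].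
    have [n Hn] : exists n, t / (t - x) <= n%:R.
      by exists (Num.truncn (t / (t - x))).+1; exact/ltW/truncnS_gt.
    exists n => //=; rewrite in_itv/= x0/= /b lerBrDr addrC -lerBrDr.
    have tx : 0 < t - x by rewrite subr_gt0.
    rewrite ler_pdivrMr// mulrC -ler_pdivrMr//.
    by rewrite (le_trans Hn)// ler_nat ltnW// ltnW.
  by rewrite x0 (le_lt_trans xt).
have dS (x : R) : x < t ->
    is_derive x 1 (fun x => - (2 * Num.sqrt (t - x))) ((Num.sqrt (t - x))^-1).
  move=> xt; have tx : 0 < t - x by rewrite subr_gt0.
  have ? := is_derive1_sqrt tx.
  have ? : is_derive x 1 (fun x => t - x) (-1).
    by apply: is_derive_eq; ring.
  apply: is_derive_eq; rewrite /GRing.scale/=; field.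
  by rewrite gt_eqF// sqrtr_gt0.
have wS n : {within `[0%R, b n], continuous (fun x => (Num.sqrt (t - x))^-1)}.
  apply: continuous_in_subspaceT => x; rewrite inE/= in_itv/= => /andP[_ xb].
  exact: continuous_inv_sqrt (le_lt_trans xb (bt n)).
rewrite UE; have cvgI : (\int[lebesgue_measure]_(x in `[0%R, b n])
    ((Num.sqrt (t - x))^-1)%:E)%E @[n --> \oo] -->
    (\int[lebesgue_measure]_(x in \bigcup_n `[0%R, b n]%classic) ((Num.sqrt (t - x))^-1)%:E)%E.
  apply: ge0_nondecreasing_set_cvg_integral => [||n|n x _].
  - apply/nondecreasing_seqP => n; apply/subsetPset => x /=.
    by rewrite !in_itv/= => /andP[-> /le_trans]; exact.
  - by move=> n; exact: measurable_itv.
  - by apply/measurable_EFinP; apply: subspace_continuous_measurable_fun.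
  - by rewrite lee_fin invr_ge0 sqrtr_ge0.
apply: (cvge_to_le cvgI); apply: nearW => n.
rewrite (@continuous_FTC2 _ _ (fun x => - (2 * Num.sqrt (t - x))))//.
- by rewrite subr0 -EFinB lee_fin opprK gerDr oppr_le0 mulr_ge0// sqrtr_ge0.
- split => [x||].
  + by rewrite in_itv/= => /andP[_ xb]; case: (dS x (lt_trans xb (bt n))).
  + exact/cvg_at_right_filter/(is_derive_continuous (dS 0 t0)).
  + exact/cvg_at_left_filter/(is_derive_continuous (dS _ (bt n))).
- move=> x; rewrite in_itv/= derive1E => /andP[_ xb].
  by case: (dS x (lt_trans xb (bt n))).
Qed.

End abel_integral.

(** * Differentiation of self-similar functions *)

Section self_similar.
Context {R : realType}.
Implicit Types (F dF w dw : R -> R) (lam r p q x t T : R).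

(** At t = 0 the quotient is 0 by convention, and for r != 0 the power of 0 makes the value 0, the
    initial datum. *)
Definition selfsim lam r F x t : R := lam * t `^ r * F (x / Num.sqrt t).

Lemma powR_sub_half r t : 0 < t -> t `^ (r - 2^-1) = t `^ r / Num.sqrt t.
Proof.
move=> t0; rewrite powRB; last by apply/implyP => _; rewrite gt_eqF.
by rewrite powR12_sqrt// ltW.
Qed.

Lemma powR_sub_one r t : 0 < t -> t `^ (r - 1) = t `^ r / t.
Proof.
move=> t0; rewrite powRB; last by apply/implyP => _; rewrite gt_eqF.
by rewrite powRr1// ltW.
Qed.

Lemma is_derive_selfsim_x lam r F dF x t : 0 < t ->
  (forall y : R, is_derive y 1 F (dF y)) ->
  is_derive x 1 (fun y => selfsim lam r F y t) (selfsim lam (r - 2^-1) dF x t).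
Proof.
move=> t0 FdF; rewrite /selfsim powR_sub_half//.
have ? := FdF (x / Num.sqrt t); apply: is_derive_eq; rewrite /GRing.scale/=.
by field; rewrite gt_eqF// sqrtr_gt0.
Qed.

Lemma is_derive_selfsim_t lam r F dF x t : 0 < t ->
  (forall y : R, is_derive y 1 F (dF y)) ->
  is_derive t 1 (fun s => selfsim lam r F x s)
    (selfsim lam (r - 1) (fun y => r * F y - y / 2 * dF y) x t).
Proof.
move=> t0 FdF; rewrite /selfsim.
have s0 : 0 < Num.sqrt t by rewrite sqrtr_gt0.
have ? := FdF (x / Num.sqrt t); have ? := is_derive1_powR r t0.
have ds := is_derive1_sqrt t0.
have ? := is_deriveV (lt0r_neq0 s0) ds.
apply: is_derive_eq; rewrite /GRing.scale/= powR_sub_one//.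
have ts : t = Num.sqrt t ^+ 2 by rewrite sqr_sqrtr// ltW.
set P := t `^ r; move: s0 ts; set s := Num.sqrt t; clearbody P s => s0 ->.
by field; rewrite gt_eqF.
Qed.

Lemma continuous_selfsim lam r F (z : R * R) : 0 < z.2 -> continuous F ->
  {for z, continuous (fun z : R * R => selfsim lam r F z.1 z.2)}.
Proof.
move=> z0 cF; rewrite /selfsim.
have c1 : (fun z : R * R => z.1) @ z --> z.1 by exact: cvg_fst.
have c2 : (fun z : R * R => z.2) @ z --> z.2 by exact: cvg_snd.
apply: cvgM.
  apply: cvgM; first exact: cvg_cst.
  apply: (@continuous_comp _ _ _ (fun z : R * R => z.2) (fun t => t `^ r)) => //.
  exact: (is_derive_continuous (is_derive1_powR r z0)).
apply: (@continuous_comp _ _ _ (fun z : R * R => z.1 / Num.sqrt z.2) F);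
  last exact: cF.
apply: cvgM => //; apply: cvgV; first by rewrite gt_eqF// sqrtr_gt0.
by apply: (@continuous_comp _ _ _ (fun z : R * R => z.2) Num.sqrt) => //; exact: sqrt_continuous.
Qed.

(** Points slightly to the left of t lie in the domain even when t = T. Properness makes the limit
    defining [dt] unique. *)
Lemma dt_filter_proper T t : 0 < t <= T -> ProperFilter (within `]0, T] t^').
Proof.
move=> /andP[t0 tT]; apply: Build_ProperFilter_ex => A [d /= d0 dA].
pose s := t - Num.min (d / 2) (t / 2).
have m0 : 0 < Num.min (d / 2) (t / 2) by rewrite lt_min !divr_gt0.
have md : Num.min (d / 2) (t / 2) < d.
  by rewrite gt_min ltr_pdivrMr// ltr_pMr// ltr1n.
have mt : Num.min (d / 2) (t / 2) < t.
  by rewrite gt_min [X in _ || X]ltr_pdivrMr// [X in _ || X]ltr_pMr// ltr1n orbT.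
exists s; apply: (dA s) => /=.
- by rewrite /s opprB addrC subrK ger0_norm// ltW.
- by rewrite /s -subr_eq0 addrAC subrr add0r oppr_eq0 gt_eqF.
- by rewrite in_itv/= /s subr_gt0 mt/= lerBlDr (le_trans tT)// lerDl ltW.
Qed.

Lemma dt_filterP T u x t (D : R) : 0 < t <= T -> is_derive t 1 (u x) D ->
  dt_filter T u x t --> D.
Proof.
move=> tT /is_derive1_caratheodory[g [ug cg <-]].
have := dt_filter_proper tT => PF.
apply: (@cvg_trans _ (g @ within `]0, T] t^')); last first.
  by apply: cvg_within_filter; apply: cvg_within_filter; exact: cg.
rewrite /dt_filter; apply: near_eq_cvg; exists 1 => //= s _ st _.
by rewrite ug mulfK// subr_eq0.
Qed.

Lemma dtE T u x t (D : R) : 0 < t <= T -> is_derive t 1 (u x) D -> dt T u x t = D.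
Proof.
move=> tT uD; have := dt_filter_proper tT => PF.
by apply/cvg_lim => //; exact: dt_filterP uD.
Qed.

End self_similar.

(** * The self-similar function and its regularity on the strip *)

Section self_similar_solution.
Context {R : realType}.
Implicit Types (F w dw : R -> R) (lam p x t T : R).

Lemma is_derive_unique F x (a b : R) :
  is_derive x 1 F a -> is_derive x 1 F b -> a = b.
Proof. by move=> [_ <-] [_ <-]. Qed.

Lemma odd_derive w dw : (forall x, w (- x) = - w x) ->
  (forall x : R, is_derive x 1 w (dw x)) -> forall x, dw (- x) = dw x.
Proof.
move=> wodd wdw x; have ? := wdw (- x); have ? := wdw x.
have d1 : is_derive x 1 (fun y => w (- y)) (- dw (- x)).
  by apply: is_derive_eq; rewrite /GRing.scale/=; ring.
have d2 : is_derive x 1 (fun y => w (- y)) (- dw x).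
  by under eq_fun do rewrite wodd; apply: is_derive_eq.
by apply: oppr_inj; exact: is_derive_unique d1 d2.
Qed.

Lemma spowZ p (a x : R) : 0 < a -> spow p (a * x) = a `^ p * spow p x.
Proof.
move=> a0; rewrite /spow sgrM (gtr0_sg a0) mul1r normrM (gtr0_norm a0).
by rewrite powRM ?(ltW a0)// mulrCA.
Qed.

Definition is_profile p w dw :=
  [/\ 0 < p < 1, profile_class w & profile_eq w dw (source p \o w)].

(** The exponent q of the ansatz; q p = q - 1 matches the power of t in f(u) with that in u_t. *)
Definition growth p : R := (1 - p)^-1.

Lemma growth_gt1 p : 0 < p < 1 -> 1 < growth p.
Proof.
move=> /andP[p0 p1]; have d0 : 0 < 1 - p by lra.
by rewrite /growth -[ltLHS]invr1 ltf_pV2 ?posrE//; lra.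
Qed.

Lemma growthM p : p < 1 -> growth p * p = growth p - 1.
Proof. by move=> p1; rewrite /growth; field; lra. Qed.

Lemma growth_drift p : p < 1 -> p / (1 - p) = growth p - 1.
Proof. by move=> p1; rewrite -growthM// mulrC. Qed.

Definition scaled_spow lam p y : R := lam * spow p (y / lam).

Lemma continuous_scaled_spow lam p : 0 < p -> continuous (scaled_spow lam p).
Proof.
move=> p0 x; apply: cvgM; first exact: cvg_cst.
apply: (@continuous_comp _ _ _ (fun y : R => y / lam) (spow p)).
  by apply: cvgMl; exact: cvg_id.
exact: continuous_spow.
Qed.

Lemma scaled_spow_selfsim lam p w x t : 0 < p < 1 -> 0 < lam -> 0 < t ->
  scaled_spow lam p (selfsim lam (growth p) w x t)
  = selfsim lam (growth p - 1) (spow p \o w) x t.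
Proof.
move=> /andP[p0 p1] l0 t0; rewrite /scaled_spow /selfsim /=.
have -> : lam * t `^ growth p * w (x / Num.sqrt t) / lam
    = t `^ growth p * w (x / Num.sqrt t).
  by field; rewrite gt_eqF.
by rewrite spowZ ?powR_gt0// -powRrM growthM// mulrA.
Qed.

Lemma selfsim_dx lam p w dw x t : is_profile p w dw -> 0 < t ->
  is_derive x 1 (fun y => selfsim lam (growth p) w y t)
    (selfsim lam (growth p - 2^-1) dw x t).
Proof.
by move=> [_ _ eqw] t0; apply: is_derive_selfsim_x => // y; have [] := eqw y.
Qed.

Lemma selfsim_dxE lam p w dw x t : is_profile p w dw -> 0 < t ->
  dx (selfsim lam (growth p) w) x t = selfsim lam (growth p - 2^-1) dw x t.
Proof.
by move=> pw t0; rewrite /dx derive1E; case: (selfsim_dx lam x pw t0).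
Qed.

Definition profile_d2 p w dw x := w x - x / 2 * dw x - source p (w x).

Lemma selfsim_dxx lam p w dw x t : is_profile p w dw -> 0 < t ->
  is_derive x 1 (fun y => dx (selfsim lam (growth p) w) y t)
    (selfsim lam (growth p - 1) (profile_d2 p w dw) x t).
Proof.
move=> pw t0; have [_ _ eqw] := pw.
under eq_fun do rewrite (selfsim_dxE _ _ pw t0).
rewrite (_ : growth p - 1 = growth p - 2^-1 - 2^-1); last by field.
by apply: is_derive_selfsim_x => // y; have [] := eqw y.
Qed.

Lemma selfsim_dxxE lam p w dw x t : is_profile p w dw -> 0 < t ->
  dxx (selfsim lam (growth p) w) x t
  = selfsim lam (growth p - 1) (profile_d2 p w dw) x t.
Proof.
by move=> pw t0; rewrite /dxx derive1E; case: (selfsim_dxx lam x pw t0).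
Qed.

Lemma selfsim_dt lam p w dw x t : is_profile p w dw -> 0 < t ->
  is_derive t 1 (selfsim lam (growth p) w x)
    (selfsim lam (growth p - 1) (fun y => growth p * w y - y / 2 * dw y) x t).
Proof.
by move=> [_ _ eqw] t0; apply: is_derive_selfsim_t => // y; have [] := eqw y.
Qed.

Lemma selfsim_dtE lam p w dw T x t : is_profile p w dw -> 0 < t <= T ->
  dt T (selfsim lam (growth p) w) x t
  = selfsim lam (growth p - 1) (fun y => growth p * w y - y / 2 * dw y) x t.
Proof.
move=> pw /[dup] tT /andP[t0 _]; apply: dtE => //; exact: selfsim_dt.
Qed.

Lemma within_strip_selfsim T lam r F (g : R * R -> R) : continuous F ->
  (forall x t, 0 < t <= T -> g (x, t) = selfsim lam r F x t) ->
  {within strip T, continuous g}.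
Proof.
move=> cF gE; pose h (z : R * R) := selfsim lam r F z.1 z.2.
apply: (@subspace_eq_continuous _ _ _ h) => [[x t] /[1!inE] xt|].
  exact/esym/gE.
apply: continuous_in_subspaceT => z /[1!inE] /andP[z0 _].
exact: continuous_selfsim.
Qed.

Lemma C21_selfsim lam p w dw T : is_profile p w dw ->
  C21 T (selfsim lam (growth p) w).
Proof.
move=> pw; have [hp cw eqw] := pw; have [wc _ _] := cw.
have dwc : continuous dw by move=> y; have [_ /is_derive_continuous] := eqw y.
have p0 : 0 < p by case/andP: hp.
have idc : continuous (fun y : R => y / 2 * dw y).
  by move=> y; apply: cvgM; [apply: cvgMl; exact: cvg_id|exact: dwc].
split.
- move=> x t /[dup] tT /andP[t0 _]; split.
  + by apply/cvg_ex; eexists; apply: dt_filterP => //; exact: selfsim_dt pw t0.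
  + by case: (selfsim_dx lam x pw t0).
  + by case: (selfsim_dxx lam x pw t0).
- apply: (@within_strip_selfsim _ lam (growth p - 1)
    (fun y => growth p * w y - y / 2 * dw y)) => [y|x t tT /=].
    by apply: cvgB; [apply: cvgMr; exact: wc|exact: idc].
  exact: selfsim_dtE.
- apply: (@within_strip_selfsim _ lam (growth p - 2^-1) dw) => // x t /andP[t0 _] /=.
  exact: selfsim_dxE.
- apply: (@within_strip_selfsim _ lam (growth p - 1) (profile_d2 p w dw))
    => [y|x t /andP[t0 _] /=]; last exact: selfsim_dxxE.
  apply: cvgB; first by apply: cvgB; [exact: wc|exact: idc].
  by apply: (@continuous_comp _ _ _ w (source p)); [exact: wc|exact: continuous_source].
Qed.

Lemma norm_selfsim_le lam p w dw x t : is_profile p w dw -> 0 < lam ->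
  `|selfsim lam (growth p) w x t| <= lam * t `^ growth p.
Proof.
move=> [_ cw _] l0; rewrite /selfsim normrM ger0_norm.
  by rewrite ler_piMr ?mulr_ge0 ?powR_ge0 ?(ltW l0)//; exact: profile_class_norm.
by rewrite mulr_ge0 ?powR_ge0 ?(ltW l0).
Qed.

(** At t = 0, where x / sqrt t degenerates, continuity follows from |u| <= lam t^q, uniformly in
    x. *)
Lemma continuous_cstrip_selfsim lam p w dw T : is_profile p w dw -> 0 < lam ->
  {within cstrip T, continuous (fun z : R * R => selfsim lam (growth p) w z.1 z.2)}.
Proof.
move=> pw l0; have [hp [wc _ _] _] := pw; have q1 := growth_gt1 hp.
have q0 : 0 < growth p by lra.
apply/subspace_continuousP => -[x t] /andP[/= t0 tT].
move: t0; rewrite le_eqVlt => /predU1P[t0|t0]; last first.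
  by apply: cvg_within_filter; exact: (@continuous_selfsim R lam (growth p) w (x, t)).
rewrite -t0; apply/cvgrPdist_lt => e e0.
pose d := (e / lam) `^ (growth p)^-1.
have el : 0 < e / lam by rewrite divr_gt0.
have d0 : 0 < d by rewrite powR_gt0.
have c2 : (fun z : R * R => z.2) @ (x, (0 : R)) --> (0 : R) by exact: cvg_snd.
have Hd : \forall z \near within (cstrip T) (nbhs (x, (0 : R))), `|z.2| < d.
  by apply: cvg_within; move/cvgr0_norm_lt : c2; exact.
near=> z; have zd : `|z.2| < d by near: z.
have zc : cstrip T z by near: z; exact: withinT.
have /andP[z0 _] := zc.
rewrite /from_subspace /=.
have -> : selfsim lam (growth p) w x 0 = 0.
  by rewrite /selfsim powR0 ?gt_eqF// mulr0 mul0r.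
rewrite sub0r normrN.
apply: (le_lt_trans (norm_selfsim_le _ _ pw l0)).
rewrite mulrC -ltr_pdivlMr//.
have -> : e / lam = d `^ growth p by rewrite /d -powRrM mulVf ?gt_eqF// powRr1// ltW.
by rewrite gt0_ltr_powR ?nnegrE ?(ltW d0)// -(ger0_norm z0).
Unshelve. all: by end_near. Qed.

End self_similar_solution.

(** * The initial value problem, and bounds for u_x and F_t *)

Section gradient_estimate.
Context {R : realType}.
Implicit Types (w dw : R -> R) (lam p x t T C e alpha : R).

Lemma bounded_of_le (S : Type) (A : set S) (f : S -> R) (C : R) :
  (forall z, A z -> `|f z| <= C) -> [bounded f z | z in A].
Proof.
move=> fC; exists C; split; first exact: num_real.
by move=> M CM z Az; exact: le_trans (fC z Az) (ltW CM).
Qed.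

Lemma BPC1_0 : BPC1 (fun=> 0 : R).
Proof.
have d0 : derive1 (fun=> 0 : R) = fun=> 0 :> R.
  by apply/funext => x; rewrite derive1_cst.
split.
- by apply: (@bounded_of_le _ _ _ 0) => x _; rewrite normr0.
- by move=> x; exact: cvg_cst.
- exists set0; split=> [a b|x _|x []]; first by rewrite set0I; exact: finite_set0.
  by split; [exact: derivable_cst|rewrite d0; exact: cvg_cst].
- by apply: (@bounded_of_le _ _ _ 0) => x _; rewrite d0 normr0.
Qed.

Lemma IVP_selfsim lam p w dw T : is_profile p w dw -> 0 < lam ->
  IVP_solution T (scaled_spow lam p) (fun=> 0) (selfsim lam (growth p) w).
Proof.
move=> pw l0; have [hp cw eqw] := pw; have q1 := growth_gt1 hp.
split.
- exact: continuous_cstrip_selfsim pw l0.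
- exact: C21_selfsim pw.
- apply: (@bounded_of_le _ _ _ (lam * T `^ growth p)) => -[x t] /andP[/= t0 tT].
  apply: (le_trans (norm_selfsim_le _ _ pw l0)); rewrite ler_wpM2l ?(ltW l0)//.
  by rewrite ge0_ler_powR ?nnegrE ?(le_trans t0 tT)//; lra.
- move=> x t /[dup] tT /andP[t0 _].
  rewrite (selfsim_dtE _ _ pw tT) (selfsim_dxxE _ _ pw t0) scaled_spow_selfsim//.
  rewrite /selfsim -mulrBr; congr (_ * _).
  have p1 : p < 1 by case/andP: hp.
  by rewrite /= /profile_d2 /source growth_drift//; ring.
- by move=> x; rewrite /selfsim powR0 ?mulr0 ?mul0r// gt_eqF//; lra.
Qed.

Lemma calI_selfsim lam p w dw T : is_profile p w dw -> 0 < lam ->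
  calI T (scaled_spow lam p) (fun=> 0) (selfsim lam (growth p) w).
Proof.
move=> pw l0; have [hp _ _] := pw.
have IVP := IVP_selfsim T pw l0; split=> //; split.
- by apply: continuous_scaled_spow; case/andP: hp.
- exact: BPC1_0.
- by case: IVP.
Qed.

Lemma normB_le (v : R -> R) C : (forall x, `|v x| <= C) -> (normB v <= C%:E)%E.
Proof. by move=> vC; apply: ge_ereal_sup => _ [x _ <-]; rewrite lee_fin. Qed.

Lemma le_normB (v : R -> R) x : (`|v x|%:E <= normB v)%E.
Proof. by apply: ereal_sup_ubound; exists x. Qed.

Lemma normB_ge0 (v : R -> R) : (0 <= normB v)%E.
Proof. by apply: le_trans (le_normB v 0); rewrite lee_fin. Qed.

Lemma normB_dx_selfsim_le lam p w dw C t : is_profile p w dw -> 0 < lam -> 0 < t ->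
  (forall x, `|dw x| <= C) ->
  (normB (fun x => dx (selfsim lam (growth p) w) x t)
    <= (lam * t `^ (growth p - 2^-1) * C)%:E)%E.
Proof.
move=> pw l0 t0 dwC; apply: normB_le => x; rewrite (selfsim_dxE _ _ pw t0).
have k0 : 0 <= lam * t `^ (growth p - 2^-1) by rewrite mulr_ge0 ?powR_ge0 ?ltW.
by rewrite /selfsim normrM (ger0_norm k0) ler_wpM2l.
Qed.

Lemma normB_dx_selfsim_ge lam p w dw t : is_profile p w dw -> 0 < lam -> 0 < t ->
  ((lam * t `^ (growth p - 2^-1) * dw 0)%:E
    <= normB (fun x => dx (selfsim lam (growth p) w) x t))%E.
Proof.
move=> pw l0 t0; apply: le_trans (le_normB _ 0); rewrite lee_fin.
by rewrite (selfsim_dxE _ _ pw t0) /selfsim mul0r ler_norm.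
Qed.

Lemma norm_deriv0 : norm_deriv (fun=> 0 : R) = 0%E.
Proof.
apply/eqP; rewrite eq_le; apply/andP; split.
  by apply: ge_ereal_sup => _ [x _ <-]; rewrite derive1_cst normr0.
apply: ereal_sup_ubound; exists 0 => /=; first exact: derivable_cst.
by rewrite derive1_cst normr0.
Qed.

Lemma calF_ge0 t (f : R -> R) u : (0 <= calF t f (fun=> 0%R) u)%E.
Proof.
rewrite /calF norm_deriv0 add0e mule_ge0 ?lee_fin ?invr_ge0 ?sqrtr_ge0//.
apply: integral_ge0 => tau _; rewrite mule_ge0 ?normB_ge0//.
Qed.

(** For tau < t the norm of f(u) is at most lam tau^{q-1} <= lam t^{q-1}. Freezing tau at t costs
    only a factor that tends to 1 as p tends to 0. *)
Lemma calF_selfsim_le lam p w dw t : is_profile p w dw -> 0 < lam -> 0 < t ->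
  (calF t (scaled_spow lam p) (fun=> 0%R) (selfsim lam (growth p) w)
    <= (lam * t `^ (growth p - 2^-1) * (2 / Num.sqrt pi))%:E)%E.
Proof.
move=> pw l0 t0; have [hp cw _] := pw; have q1 := growth_gt1 hp.
have p0 : 0 < p by case/andP: hp.
rewrite /calF norm_deriv0 add0e; set c := lam * t `^ (growth p - 1).
have c0 : 0 <= c by rewrite mulr_ge0 ?powR_ge0 ?ltW.
have s0 : 0 < Num.sqrt (pi : R) by rewrite sqrtr_gt0 pi_gt0.
have normf tau : 0 <= tau < t ->
    (normB (fun x => scaled_spow lam p (selfsim lam (growth p) w x tau)) <= c%:E)%E.
  move=> /andP[tau0 taut]; apply: normB_le => x.
  rewrite /scaled_spow normrM (gtr0_norm l0) /c ler_wpM2l ?(ltW l0)//.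
  rewrite norm_spow ?gt_eqF// -growthM ?(andP hp).2// powRrM.
  apply: ge0_ler_powR; rewrite ?nnegrE ?powR_ge0 ?(ltW p0)//.
  rewrite normrM normfV (gtr0_norm l0) ler_pdivrMr// mulrC.
  apply: (le_trans (norm_selfsim_le _ _ pw l0)); rewrite ler_wpM2l ?(ltW l0)//.
  by rewrite ge0_ler_powR ?nnegrE ?(ltW t0) ?(ltW taut)//; lra.
apply: (@le_trans _ _ ((Num.sqrt pi)^-1%:E * (c%:E * (2 * Num.sqrt t)%:E))%E).
  rewrite lee_pmul2l ?lte_fin ?invr_gt0//.
  apply: (@le_trans _ _ (\int[lebesgue_measure]_(tau in `[0%R, t[)
      (c%:E * ((Num.sqrt (t - tau))^-1)%:E))%E).
    apply: ge0_le_integral_sup => tau; rewrite /= in_itv/= => ht.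
    have i0 : 0 <= (Num.sqrt (t - tau))^-1 by rewrite invr_ge0 sqrtr_ge0.
    by rewrite mule_ge0 ?normB_ge0 ?lee_fin//= lee_wpmul2r ?lee_fin// normf.
  rewrite ge0_integralZl//; last exact: measurable_inv_sqrt.
  by rewrite lee_wpmul2l ?lee_fin// integral_inv_sqrt_le.
rewrite -!EFinM lee_fin /c powR_sub_one// powR_sub_half//.
have st0 : 0 < Num.sqrt t by rewrite sqrtr_gt0.
have ts : t = Num.sqrt t ^+ 2 by rewrite sqr_sqrtr// ltW.
rewrite le_eqVlt; apply/orP; left; apply/eqP.
set P := t `^ _; move: st0 ts; set s := Num.sqrt t; clearbody P s => st0 ->.
by field; rewrite !gt_eqF.
Qed.

End gradient_estimate.

(** * The infimum of the gap, and the theorem *)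

Section small_gap.
Context {R : realType}.

Lemma profile_deriv_bounded (p : R) w dw : p <= 3^-1 -> is_profile p w dw ->
  exists C, 0 <= C /\ forall x, `|dw x| <= C.
Proof.
move=> p3 [hp cw eqw]; have [_ wodd _] := cw; exists (`|dw 0| + 4 * 1).
split=> [|x]; first by rewrite addr_ge0// mulr_ge0.
have dwe := odd_derive wodd (fun y => (eqw y).1).
wlog x0 : x / 0 <= x => [H|].
  by have [/H//|/ltW] := leP 0 x; rewrite -oppr_ge0 => /H; rewrite dwe.
apply: (profile_eq_deriv_le eqw) => // y _; first exact: profile_class_norm cw.
apply: norm_source_le; last exact: profile_class_norm cw.
by case/andP: hp => ->.
Qed.

Definition gap (f u0 : R -> R) (u : R -> R -> R) t : \bar R :=
  (normB (fun x => dx u x t) - calF t f u0 u)%E.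

Definition inf_gap T (f u0 : R -> R) (u : R -> R -> R) : \bar R :=
  ereal_inf [set gap f u0 u t | t in `]0, T]].

(** The free factor lam is fixed by u_x(0, T) = alpha. As e <= 1/2 and 2 / sqrt pi >= 1, the slope
    of the profile is at least 1/2, so lam t^{q - 1/2} <= 2 alpha for all t <= T, and the error e in
    the slope becomes at most 2 alpha e in the gap. *)
Lemma exists_small_gap (alpha T e : R) : 0 < alpha -> 0 < T -> 0 < e <= 2^-1 ->
  exists fu : (R -> R) * (R -> R -> R), calI_alpha alpha T fu.1 (fun=> 0) fu.2 /\
   ((- (2 * alpha * e))%:E <=
      inf_gap T fu.1 (fun=> 0%R) fu.2 <= 0)%E.
Proof.
move=> al0 T0 /andP[e0 e2].
have [p [w [dw [/andP[p0 p258] cw eqw slope]]]] := exists_steep_profile e0.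
have hp : 0 < p < 1 by rewrite p0; lra.
have pw : is_profile p w dw by split.
have /andP[s1 s2] := @sqrt_pi_bounds R.
have s0 : 0 < Num.sqrt (pi : R) by lra.
have S1 : 1 <= 2 / Num.sqrt (pi : R) by rewrite ler_pdivlMr// mul1r.
have d0 : 2^-1 <= dw 0 by lra.
have q1 := growth_gt1 hp; set r := growth p - 2^-1.
have r0 : 0 < r by rewrite /r; lra.
pose a := T `^ r; have a0 : 0 < a by rewrite powR_gt0.
pose lam := alpha / (a * dw 0).
have dw0 : 0 < dw 0 by lra.
have l0 : 0 < lam by rewrite divr_gt0// mulr_gt0.
have lE : lam * a * dw 0 = alpha by rewrite /lam; field; rewrite !gt_eqF.
exists (scaled_spow lam p, selfsim lam (growth p) w) => /=; split.
  split; first exact: calI_selfsim pw l0.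
  by rewrite -lE; exact: normB_dx_selfsim_ge pw l0 T0.
apply/andP; split.
  apply: le_ereal_inf_tmp => _ [t + <-]; rewrite /= in_itv/= => /andP[t0 tT].
  apply: le_trans (leeB (normB_dx_selfsim_ge pw l0 t0) (calF_selfsim_le pw l0 t0)).
  rewrite -EFinB lee_fin -mulrBr -/r.
  have ta : t `^ r <= a by rewrite ge0_ler_powR ?nnegrE ?(ltW t0) ?(ltW T0) ?(ltW r0).
  have tr0 := powR_ge0 t r.
  have la : lam * t `^ r <= 2 * alpha.
    apply: (@le_trans _ _ (lam * a)); first by rewrite ler_wpM2l// ltW.
    have := mulr_gt0 l0 a0; nra.
  have : 0 <= lam * t `^ r by rewrite mulr_ge0// ltW.
  set k := lam * _ in la *; set S := 2 / _ in slope *; nra.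
have p3 : p <= 3^-1 by lra.
have [C [C0 dwC]] := profile_deriv_bounded p3 pw.
apply/lee_addgt0Pr => eta eta0; rewrite add0e.
have lC : 0 < lam * C + 1 by rewrite ltr_wpDl// mulr_ge0// ltW.
(* At this t the bound lam t^r C on |u_x| is at most eta; the summand 1 keeps the denominator
   positive when C = 0. *)
pose t := Num.min T ((eta / (lam * C + 1)) `^ r^-1).
have k0 : 0 < eta / (lam * C + 1) by rewrite divr_gt0.
have t0 : 0 < t by rewrite lt_min T0 powR_gt0.
have tT : t <= T by rewrite ge_min lexx.
have tk : t <= (eta / (lam * C + 1)) `^ r^-1 by rewrite ge_min lexx orbT.
have tr : t `^ r <= eta / (lam * C + 1).
  apply: (@le_trans _ _ (((eta / (lam * C + 1)) `^ r^-1) `^ r)).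
    by apply: ge0_ler_powR; rewrite ?nnegrE ?powR_ge0// ltW.
  by rewrite -powRrM mulVf ?gt_eqF// powRr1// ltW.
apply: (@le_trans _ _ (gap (scaled_spow lam p) (fun=> 0) (selfsim lam (growth p) w) t)).
  by apply: ereal_inf_lbound; exists t => //=; rewrite in_itv/= t0.
apply: (@le_trans _ _ (normB (fun x => dx (selfsim lam (growth p) w) x t))).
  by rewrite /gap geeDl// leeNl oppe0 calF_ge0.
apply: (le_trans (normB_dx_selfsim_le pw l0 t0 dwC)); rewrite lee_fin -/r.
have := powR_ge0 t r; move: tr; rewrite ler_pdivlMr//; set P := t `^ r; nra.
Qed.

End small_gap.

Unset Implicit Arguments.

Theorem theorem1p1 (R : realType) (alpha T : R) (alpha_gt0 : 0 < alpha)
    (T_gt0 : 0 < T) :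
  exists (u0 : R -> R) (f : nat -> R -> R) (u : nat -> R -> R -> R),
    [/\ BPC1 u0,
        forall n, calI_alpha alpha T (f n) u0 (u n)
      & (fun n => ereal_inf
           [set (normB (fun x => dx (u n) x t) - calF t (f n) u0 (u n))%E
             | t in `]0, T]]) @ \oo --> 0%E].
Proof.
(* The factor 1/2 secures e n <= 1/2, as [exists_small_gap] demands. *)
pose e n : R := 2^-1 * harmonic n.
have e01 n : 0 < e n <= 2^-1.
  rewrite /e /harmonic mulr_gt0 ?invr_gt0//= ler_piMr// invf_le1// ler1n.
  by [].
have /choice[fu Hfu] := fun n => exists_small_gap alpha_gt0 T_gt0 (e01 n).
exists (fun=> 0), (fun n => (fu n).1), (fun n => (fu n).2); split.
- exact: BPC1_0.
- by move=> n; have [] := Hfu n.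
apply: (@squeeze_cvge _ _ _ _ (fun n => (- (2 * alpha * e n))%:E) _ (cst 0%E)).
- by apply: nearW => n; have [_] := Hfu n.
- apply: cvg_EFin; first by apply: nearW.
  rewrite -[X in _ --> X](_ : - (2 * alpha * (2^-1 * 0)) = _); last by rewrite !mulr0 oppr0.
  apply: cvgN; apply: cvgMr; apply: cvgMr; exact: cvg_harmonic.
- exact: cvg_cst.
Qed.
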